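(* Let $\alpha:\mathbb{R}\to\mathbb{R}^2\equiv\{x_3=0\}\subset\mathbb{R}^3$ be a smooth, $L$-periodic, arc-length parametrized curve whose trace $C$ is a simple closed curve of length $L$, traversed counterclockwise, and let $\Omega$ be the bounded domain enclosed by $C$, with area $|\Omega|$. For $l>0$ let $M$ be the cylindrical column $x(t,s)=\alpha(s)+tE_3$, $t\in[0,l]$, $s\in[0,L]$, oriented by the Gauss map $N(t,s)=E_3\wedge\alpha'(s)$. Suppose $M$ is a rotating stationary surface, i.e. its mean curvature satisfies $2H=a(x_1^2+x_2^2)+b$ on $M$ for constants $a,b\in\mathbb{R}$ (equivalently, the curvature $\kappa$ of $\alpha$ satisfies $\kappa(s)=a|\alpha(s)|^2+b$). If $a>0$ and $M$ is stable, then $$l\le \frac{\pi}{2}\sqrt{\frac{L}{a|\Omega|}}.$$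
   Context: $E_1,E_2,E_3$ is the standard basis of $\mathbb{R}^3$, $\wedge$ the cross product. The curvature $\kappa$ of $\alpha$ is defined by $\alpha''=\kappa\,\mathbf{n}$ with $\mathbf{n}=J\alpha'$, $J$ the counterclockwise rotation by $\pi/2$ in the $x_1x_2$-plane (so $N=\mathbf{n}$ and $2H=\kappa$). For a surface $M$ with Gauss map $N$, second fundamental form $\sigma$, Laplace–Beltrami operator $\Delta$, support function $h=\langle N,x\rangle$, $N_3=\langle N,E_3\rangle$, $x_3=\langle x,E_3\rangle$, satisfying $2H=a(x_1^2+x_2^2)+b$, stability means: $\Phi(u):=-\int_M u\big(\Delta u+(|\sigma|^2-2a(h-x_3N_3))u\big)\,dM\ge 0$ for every smooth $u$ on $M$ vanishing on the boundary $\partial M$ (here: on $t=0$ and $t=l$, and $L$-periodic in $s$) with $\int_M u\,dM=0$. For the column, $\Delta=\partial_t^2+\partial_s^2$, $|\sigma|^2=\kappa(s)^2$ and $h-x_3N_3=-\langle\alpha(s)\wedge\alpha'(s),E_3\rangle$. *)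

(* Defs.v *)
From Stdlib Require Import Reals Lra List ClassicalEpsilon.
Open Scope R_scope.

(* The derivative of f at x (the unique l with derivable_pt_lim f x l when
   f is differentiable at x; an unspecified value otherwise). *)
Definition Der (f : R -> R) (x : R) : R :=
  epsilon (inhabits 0) (fun l => derivable_pt_lim f x l).

Fixpoint nDer (n : nat) (f : R -> R) : R -> R :=
  match n with O => f | S m => Der (nDer m f) end.

Definition smooth (f : R -> R) : Prop :=
  forall n x, derivable_pt_lim (nDer n f) x (nDer (S n) f x).

(* Riemann integral of f over [a,b] (0 if f is not Riemann integrable). *)
Definition RInt (f : R -> R) (a b : R) : R :=
  match excluded_middle_informative (inhabited (Riemann_integrable f a b)) with
  | left H => RiemannInt (epsilon H (fun _ => True))
  | right _ => 0
  end.

Definition Dt (u : R -> R -> R) : R -> R -> R := fun t s => Der (fun t' => u t' s) t.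
Definition Ds (u : R -> R -> R) : R -> R -> R := fun t s => Der (fun s' => u t s') s.

Fixpoint pder (w : list bool) (u : R -> R -> R) : R -> R -> R :=
  match w with
  | nil => u
  | b :: w' => (if b then Dt else Ds) (pder w' u)
  end.

Definition continuous2 (f : R -> R -> R) : Prop :=
  forall t s eps, 0 < eps -> exists del, 0 < del /\
    forall t' s', Rabs (t' - t) < del -> Rabs (s' - s) < del ->
      Rabs (f t' s' - f t s) < eps.

Definition smooth2 (u : R -> R -> R) : Prop :=
  forall w, continuous2 (pder w u) /\
    forall t s,
      derivable_pt_lim (fun t' => pder w u t' s) t (pder (true :: w) u t s) /\
      derivable_pt_lim (fun s' => pder w u t s') s (pder (false :: w) u t s).

Definition Lap (u : R -> R -> R) : R -> R -> R :=
  fun t s => Dt (Dt u) t s + Ds (Ds u) t s.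

Record V3 := mkV3 { vx : R; vy : R; vz : R }.
Definition dot3 (u v : V3) : R := vx u * vx v + vy u * vy v + vz u * vz v.
Definition cross (u v : V3) : V3 :=
  mkV3 (vy u * vz v - vz u * vy v) (vz u * vx v - vx u * vz v) (vx u * vy v - vy u * vx v).
Definition E3 : V3 := mkV3 0 0 1.

(* curvature: alpha'' = kappa n with n = J alpha', J = rotation by +pi/2 *)
Definition kappa (a1 a2 : R -> R) (s : R) : R :=
  nDer 2 a1 s * (- Der a2 s) + nDer 2 a2 s * Der a1 s.

Definition alpha' (a1 a2 : R -> R) (s : R) : V3 := mkV3 (Der a1 s) (Der a2 s) 0.

Definition xM (a1 a2 : R -> R) (t s : R) : V3 := mkV3 (a1 s) (a2 s) t.
Definition NM (a1 a2 : R -> R) (t s : R) : V3 := cross E3 (alpha' a1 a2 s).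
Definition hM (a1 a2 : R -> R) (t s : R) : R := dot3 (NM a1 a2 t s) (xM a1 a2 t s).
Definition N3 (a1 a2 : R -> R) (t s : R) : R := dot3 (NM a1 a2 t s) E3.
Definition x3 (a1 a2 : R -> R) (t s : R) : R := dot3 (xM a1 a2 t s) E3.
(* For the column, |sigma|^2 = kappa^2 and 2H = kappa (N = n). *)
Definition sigma2 (a1 a2 : R -> R) (t s : R) : R := kappa a1 a2 s ^ 2.
Definition twoH (a1 a2 : R -> R) (t s : R) : R := kappa a1 a2 s.

(* integral over M with dM = dt ds, t in [0,l], s in [0,L] *)
Definition IntM (L l : R) (f : R -> R -> R) : R :=
  RInt (fun s => RInt (fun t => f t s) 0 l) 0 L.

Definition Phi (a1 a2 : R -> R) (L l a : R) (u : R -> R -> R) : R :=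
  - IntM L l (fun t s =>
      u t s * (Lap u t s
               + (sigma2 a1 a2 t s
                  - 2 * a * (hM a1 a2 t s - x3 a1 a2 t s * N3 a1 a2 t s)) * u t s)).

Definition stable (a1 a2 : R -> R) (L l a : R) : Prop :=
  forall u : R -> R -> R,
    smooth2 u ->
    (forall t s, u t (s + L) = u t s) ->
    (forall s, u 0 s = 0 /\ u l s = 0) ->
    IntM L l u = 0 ->
    Phi a1 a2 L l a u >= 0.

Definition onC (a1 a2 : R -> R) (p : R * R) : Prop :=
  exists s, p = (a1 s, a2 s).

(* p lies in the bounded domain enclosed by C: p is not on C and its
   (path-)component in R^2 \ C is bounded. *)
Definition inside (a1 a2 : R -> R) (p : R * R) : Prop :=
  ~ onC a1 a2 p /\
  exists Rb, forall g1 g2 : R -> R,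
    (forall tau, continuity_pt g1 tau) -> (forall tau, continuity_pt g2 tau) ->
    (g1 0, g2 0) = p ->
    (forall tau, 0 <= tau <= 1 -> ~ onC a1 a2 (g1 tau, g2 tau)) ->
    forall tau, 0 <= tau <= 1 -> g1 tau ^ 2 + g2 tau ^ 2 <= Rb ^ 2.

(* rectangles [x0,x1] x [y0,y1] *)
Definition rect := (R * R * R * R)%type.
Definition rect_ok (Om : R * R -> Prop) (r : rect) : Prop :=
  let '(x0, x1, y0, y1) := r in
  x0 < x1 /\ y0 < y1 /\
  forall x y, x0 <= x <= x1 -> y0 <= y <= y1 -> Om (x, y).
Definition rect_area (r : rect) : R :=
  let '(x0, x1, y0, y1) := r in (x1 - x0) * (y1 - y0).
Definition rect_disj (r r' : rect) : Prop :=
  let '(x0, x1, y0, y1) := r in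
  let '(x0', x1', y0', y1') := r' in
  x1 <= x0' \/ x1' <= x0 \/ y1 <= y0' \/ y1' <= y0.
Fixpoint rects_disj (rs : list rect) : Prop :=
  match rs with
  | nil => True
  | r :: rs' => Forall (rect_disj r) rs' /\ rects_disj rs'
  end.

(* Area (= inner Jordan content = Lebesgue measure for open sets): the
   supremum of total areas of finitely many interior-disjoint rectangles
   contained in Om. *)
Definition is_area (Om : R * R -> Prop) (A : R) : Prop :=
  is_lub (fun r => exists rs : list rect,
            Forall (rect_ok Om) rs /\ rects_disj rs /\
            r = fold_right (fun q acc => rect_area q + acc) 0 rs) A.

(* Main.v *)
(** Write [alpha = (a1, a2)], [n = J alpha'] and [w = a1 a2' - a2 a1'].  The functions
    [u_i (t, s) = sin (pi t / l) <alpha' s, E_i>], [i = 1, 2], are admissible, and since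
    [<alpha', alpha'''> = - kappa^2] the curvature cancels from the sum of their second
    variations: [Phi u_1 + Phi u_2 = (l / 2) (pi^2 L / l^2 - 2 a int w)].  Stability thus gives
    [2 a int w <= pi^2 L / l^2], and it remains to see that [0 < 2 |Omega| <= int w].

    For the area inequality, let [W p] be the winding number of the curve around [p], mollified
    at a small scale [d].  It is constant along paths at distance at least [2 d] from the curve
    and nondecreasing when the curve is crossed along [n], and it is [0] just below a lowest point
    of the curve and [1] just above it.  Following the two curves parallel to [alpha], and the
    normal from a nearest point of [alpha] elsewhere, one gets [0 <= W] everywhere and [W = 1] at
    the enclosed points away from the curve.  The integral of [W] over a large square, which is
    [(1 / 2) int w], therefore bounds the total area of disjoint rectangles contained in
    [Omega]. *)

Require Import Defs.
From Stdlib Require Import Reals ZArith Lra Lia List ClassicalEpsilon FunctionalExtensionality.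
From Coquelicot Require Import Coquelicot.
Open Scope R_scope.

(** * Calculus of one and two variables *)

Lemma Der_unique (f : R -> R) (x y : R) : is_derive f x y -> Der f x = y.
Proof.
  intros H%is_derive_Reals.
  apply (uniqueness_limite f x); [| exact H].
  unfold Der. apply epsilon_spec. now exists y.
Qed.

Lemma Defs_RInt_unique (f : R -> R) (a b v : R) : is_RInt f a b v -> Defs.RInt f a b = v.
Proof.
  intros H. unfold Defs.RInt.
  destruct (excluded_middle_informative (inhabited (Riemann_integrable f a b))) as [i | n].
  - rewrite <- RInt_Reals. now apply is_RInt_unique.
  - exfalso. apply n. constructor. apply ex_RInt_Reals_0. now exists v.
Qed.

Lemma continuity_pt_continuous (f : R -> R) (x : R) : continuity_pt f x <-> continuous f x.
Proof. apply continuity_pt_filterlim. Qed.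

Lemma is_derive_continuity (f df : R -> R) : (forall x, is_derive f x (df x)) -> continuity f.
Proof.
  intros H x. apply continuity_pt_continuous, (ex_derive_continuous f).
  now exists (df x).
Qed.

Lemma is_derive_Rmult_const_r (f : R -> R) (c x l : R) :
  is_derive f x l -> is_derive (fun x => f x * c) x (l * c).
Proof. exact (is_derive_scal_l f x l c). Qed.

Lemma is_derive_Rmult (f g : R -> R) (x l m : R) :
  is_derive f x l -> is_derive g x m -> is_derive (fun x => f x * g x) x (l * g x + f x * m).
Proof. intros Hf Hg. exact (is_derive_mult f g x l m Hf Hg Rmult_comm). Qed.

Lemma is_RInt_continuity (f : R -> R) (a b : R) :
  continuity f -> is_RInt f a b (RInt f a b).
Proof.
  intros Hf. apply (RInt_correct f), (ex_RInt_continuous f).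
  intros x _. apply continuity_pt_continuous, Hf.
Qed.

Lemma is_RInt_derive_continuity (f df : R -> R) (a b : R) :
  (forall x, is_derive f x (df x)) -> continuity df -> is_RInt df a b (f b - f a).
Proof.
  intros Hf Hdf. apply (is_RInt_derive f df a b).
  - intros x _. apply Hf.
  - intros x _. apply continuity_pt_continuous, Hdf.
Qed.

Lemma is_derive_RInt_continuity (f : R -> R) (a x : R) :
  continuity f -> is_derive (fun y => RInt f a y) x (f x).
Proof.
  intros Hf. apply (is_derive_RInt f (fun y => RInt f a y) a).
  - apply filter_forall. intros y. now apply is_RInt_continuity.
  - apply continuity_pt_continuous, Hf.
Qed.

Lemma is_RInt_constant (f : R -> R) (a b v : R) :
  (forall x, Rmin a b < x < Rmax a b -> f x = v) -> is_RInt f a b ((b - a) * v).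
Proof.
  intros H. apply (is_RInt_ext (fun _ => v)).
  - intros x Hx. now rewrite H.
  - exact (is_RInt_const a b v).
Qed.

Lemma is_RInt_vanishing (f : R -> R) (a b : R) :
  (forall x, Rmin a b < x < Rmax a b -> f x = 0) -> is_RInt f a b 0.
Proof.
  intros H. replace 0 with ((b - a) * 0) by ring. now apply is_RInt_constant.
Qed.

Lemma is_RInt_plus_scal (f g h : R -> R) (a b v w k : R) :
  is_RInt f a b v -> is_RInt g a b w -> (forall x, h x = f x + k * g x) ->
  is_RInt h a b (v + k * w).
Proof.
  intros Hf Hg Hh. apply (is_RInt_ext (fun x => f x + k * g x)).
  - intros x _. now rewrite Hh.
  - exact (is_RInt_plus f _ a b v _ Hf (is_RInt_scal g a b k w Hg)).
Qed.

Lemma is_derive_constant (f : R -> R) (v x l : R) :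
  (forall y, f y = v) -> is_derive f x l -> l = 0.
Proof.
  intros Hf Hl. rewrite <- (is_derive_unique f x l Hl).
  apply is_derive_unique, (is_derive_ext (fun _ => v)).
  - intros y. now rewrite Hf.
  - exact (is_derive_const v x).
Qed.

Lemma is_derive_minimum (f : R -> R) (x l : R) :
  is_derive f x l -> (forall y, f x <= f y) -> l = 0.
Proof.
  intros Hl%is_derive_Reals Hmin.
  assert (pr : derivable_pt f x) by now exists l.
  rewrite <- (deriv_minimum f (x - 1) (x + 1) x pr) by (lra || intros; apply Hmin).
  symmetry. now apply derive_pt_eq_0.
Qed.

Lemma lipschitz_of_derive_bound (f df : R -> R) (K x y : R) :
  (forall z, is_derive f z (df z)) -> (forall z, Rabs (df z) <= K) ->
  Rabs (f y - f x) <= K * Rabs (y - x).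
Proof. intros Hf HK. apply (bounded_variation f df). auto. Qed.

Lemma taylor1_remainder_bound (f df ddf : R -> R) (K x y : R) :
  (forall z, is_derive f z (df z)) -> (forall z, is_derive df z (ddf z)) ->
  (forall z, Rabs (ddf z) <= K) ->
  Rabs (f y - f x - df x * (y - x)) <= K * (y - x) ^ 2.
Proof.
  intros Hf Hdf HK.
  assert (Hg : forall z, Rabs (z - x) <= Rabs (y - x) ->
            is_derive (fun z => f z - df x * z) z (df z - df x) /\
            Rabs (df z - df x) <= K * Rabs (y - x)).
  { intros z Hz. split.
    - apply (is_derive_minus f (fun z => df x * z)); [apply Hf |].
      auto_derive; [exact I | ring].
    - apply Rle_trans with (K * Rabs (z - x)).
      + now apply (lipschitz_of_derive_bound df ddf).
      + apply Rmult_le_compat_l; [| exact Hz].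
        exact (Rle_trans _ _ _ (Rabs_pos (ddf x)) (HK x)). }
  replace (f y - f x - df x * (y - x)) with ((f y - df x * y) - (f x - df x * x)) by ring.
  rewrite <- (pow2_abs (y - x)), <- Rsqr_pow2. unfold Rsqr. rewrite <- Rmult_assoc.
  exact (bounded_variation (fun z => f z - df x * z) _ _ x y Hg).
Qed.

Lemma Rmax_Rabs (x y : R) : Rmax x y = (x + y + Rabs (x - y)) / 2.
Proof. unfold Rmax, Rabs. destruct (Rle_dec x y), (Rcase_abs (x - y)); lra. Qed.

Lemma Rmin_Rabs (x y : R) : Rmin x y = (x + y - Rabs (x - y)) / 2.
Proof. unfold Rmin, Rabs. destruct (Rle_dec x y), (Rcase_abs (x - y)); lra. Qed.

Lemma continuity_Rmax (x : R) : continuity (Rmax x).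
Proof.
  intros y. apply (continuity_pt_ext (fun y => (x + y + Rabs (x - y)) / 2)).
  - intros z. now rewrite Rmax_Rabs.
  - reg.
Qed.

Lemma continuity_Rmin (x : R) : continuity (Rmin x).
Proof.
  intros y. apply (continuity_pt_ext (fun y => (x + y - Rabs (x - y)) / 2)).
  - intros z. now rewrite Rmin_Rabs.
  - reg.
Qed.

Definition clamp (u v x : R) : R := Rmax u (Rmin v x).

Lemma clamp_between (u v x : R) : u <= v -> u <= clamp u v x <= v.
Proof.
  intros H. split; [apply Rmax_l |]. apply Rmax_lub; [exact H | apply Rmin_l].
Qed.

Lemma clamp_left (u v x : R) : u <= v -> x <= u -> clamp u v x = u.
Proof. intros H Hx. apply Rmax_left. rewrite Rmin_right; lra. Qed.

Lemma clamp_right (u v x : R) : u <= v -> v <= x -> clamp u v x = v.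
Proof. intros H Hx. unfold clamp. rewrite Rmin_left by lra. now apply Rmax_right. Qed.

Lemma clamp_id (u v x : R) : u <= x <= v -> clamp u v x = x.
Proof. intros H. unfold clamp. rewrite Rmin_right, Rmax_right; lra. Qed.

Lemma clamp_nearest (u v x y : R) : u <= y <= v -> (x - clamp u v x) ^ 2 <= (x - y) ^ 2.
Proof.
  intros Hy. destruct (Rle_lt_dec x u) as [h | h]; [| destruct (Rle_lt_dec v x) as [h' | h']].
  - rewrite clamp_left by lra. nra.
  - rewrite clamp_right by lra. nra.
  - rewrite clamp_id, Rminus_diag by lra. assert (H := pow2_ge_0 (x - y)). lra.
Qed.

Lemma continuity_clamp (u v : R) : continuity (clamp u v).
Proof.
  intros x. apply (continuity_pt_comp (Rmin v) (Rmax u)).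
  - apply continuity_Rmin.
  - apply continuity_Rmax.
Qed.

(** * Continuous functions of two variables *)

Ltac continuity_2d :=
  lazymatch goal with
  | |- continuity_2d_pt (fun _ v => v) _ _ => apply continuity_2d_pt_id2
  | |- continuity_2d_pt (fun u _ => u) _ _ => apply continuity_2d_pt_id1
  | |- continuity_2d_pt (fun _ _ => ?c) _ _ => apply continuity_2d_pt_const
  | |- continuity_2d_pt (fun u v => @?f u v + @?g u v) _ _ =>
      apply (continuity_2d_pt_plus f g); continuity_2d
  | |- continuity_2d_pt (fun u v => @?f u v - @?g u v) _ _ =>
      apply (continuity_2d_pt_minus f g); continuity_2d
  | |- continuity_2d_pt (fun u v => @?f u v * @?g u v) _ _ =>
      apply (continuity_2d_pt_mult f g); continuity_2d
  | |- continuity_2d_pt (fun u v => - @?f u v) _ _ =>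
      apply (continuity_2d_pt_opp f); continuity_2d
  | |- continuity_2d_pt (fun u v => @?f u v ^ ?n) _ _ =>
      apply (continuity_1d_2d_pt_comp (fun x => x ^ n) f); [reg | continuity_2d]
  | |- continuity_2d_pt (fun u v => ?f (@?g u v)) _ _ =>
      apply (continuity_1d_2d_pt_comp f g); [| continuity_2d];
      try (match goal with H : continuity f |- _ => apply H end)
  end.

Lemma continuity_2d_section (f : R -> R -> R) (x : R) :
  (forall x y, continuity_2d_pt f x y) -> continuity (f x).
Proof.
  intros Hf y. apply continuity_pt_continuous, (continuous_comp_2 (fun _ => x) (fun t => t) f).
  - apply continuous_const.
  - apply continuous_id.
  - apply continuity_2d_pt_filterlim, Hf.
Qed.

Lemma continuity_2d_flip (f : R -> R -> R) :
  (forall x y, continuity_2d_pt f x y) ->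
  forall x y, continuity_2d_pt (fun u v => f v u) x y.
Proof.
  intros Hf x y eps. destruct (Hf y x eps) as [delta Hdelta].
  exists delta. intros u v Hu Hv. now apply Hdelta.
Qed.

Lemma continuity_RInt_param (f : R -> R -> R) (a b : R) :
  (forall x y, continuity_2d_pt f x y) -> continuity (fun x => RInt (fun t => f x t) a b).
Proof.
  intros Hf x eps Heps.
  assert (Hint : forall y, is_RInt (fun t => f y t) a b (RInt (fun t => f y t) a b)).
  { intros y. now apply is_RInt_continuity, continuity_2d_section. }
  set (eta := eps / (2 * (Rabs (b - a) + 1))).
  assert (Hba := Rabs_pos (b - a)).
  assert (Heta : 0 < eta) by (apply Rdiv_lt_0_compat; lra).
  destruct (uniform_continuity_2d_1d' f (Rmin a b) (Rmax a b) x (fun t _ => Hf x t)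
              (mkposreal eta Heta)) as [delta Hdelta].
  exists delta. split; [apply cond_pos |]. intros y [_ Hy].
  unfold dist in *; simpl in *; unfold Rdist in *. apply Rabs_def2 in Hy.
  apply Rle_lt_trans with (Rabs (b - a) * eta).
  - apply (norm_RInt_le_const_abs (fun t => minus (f y t) (f x t)) a b).
    + intros t Ht. apply Rlt_le, Hdelta; try lra.
      rewrite Rminus_diag, Rabs_R0. apply cond_pos.
    + exact (is_RInt_minus _ _ _ _ _ _ (Hint y) (Hint x)).
  - replace (Rabs (b - a) * eta) with (eps * (Rabs (b - a) / (2 * (Rabs (b - a) + 1))))
      by (unfold eta; field; lra).
    rewrite <- (Rmult_1_r eps) at 2. apply Rmult_lt_compat_l; [exact Heps |].
    apply Rlt_div_l; lra.
Qed.

Lemma is_derive_RInt_param_C1 (f df : R -> R -> R) (a b x : R) :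
  (forall u t, is_derive (fun u => f u t) u (df u t)) ->
  (forall u t, continuity_2d_pt df u t) ->
  (forall u, continuity (f u)) ->
  is_derive (fun u => RInt (f u) a b) x (RInt (df x) a b).
Proof.
  intros Hf Hdf Hcont. evar_last.
  - apply (is_derive_RInt_param f a b x).
    + apply filter_forall. intros u t _. exists (df u t). apply Hf.
    + intros t _. apply (continuity_2d_pt_ext df); [| apply Hdf].
      intros u v. symmetry. apply is_derive_unique, Hf.
    + apply filter_forall. intros u.
      exists (RInt (f u) a b). now apply is_RInt_continuity.
  - apply RInt_ext. intros t _. apply is_derive_unique, Hf.
Qed.

Lemma is_RInt_swap_order (f : R -> R -> R) (h : R -> R) (a b c d : R) :
  (forall x y, continuity_2d_pt f x y) -> (forall y, is_RInt (fun x => f x y) a b (h y)) ->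
  is_RInt (fun x => RInt (f x) c d) a b (RInt h c d).
Proof.
  intros Hf Hh. assert (Hf' := continuity_2d_flip f Hf).
  set (F := fun x y => RInt (fun t => f t y) a x).
  assert (HF : forall x, is_derive (fun x => RInt (F x) c d) x (RInt (f x) c d)).
  { intros x. apply is_derive_RInt_param_C1; [| exact Hf |].
    - intros u y. apply (is_derive_RInt_continuity (fun t => f t y)).
      exact (continuity_2d_section (fun y t => f t y) y Hf').
    - intros u. exact (continuity_RInt_param (fun y t => f t y) a u Hf'). }
  replace (RInt h c d) with (RInt (F b) c d - RInt (F a) c d).
  - apply (is_RInt_derive_continuity (fun x => RInt (F x) c d)); [exact HF |].
    now apply continuity_RInt_param.
  - rewrite (is_RInt_unique (F a) c d 0).
    + rewrite Rminus_0_r. apply RInt_ext. intros y _. apply is_RInt_unique, Hh.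
    + apply is_RInt_vanishing. intros y _. apply (RInt_point a (fun t => f t y)).
Qed.

Lemma continuity_2d_rectangle_min (f : R -> R -> R) (a b c d : R) :
  a <= b -> c <= d -> (forall x y, continuity_2d_pt f x y) ->
  exists x0 y0, a <= x0 <= b /\ c <= y0 <= d /\
    forall x y, a <= x <= b -> c <= y <= d -> f x0 y0 <= f x y.
Proof.
  intros Hab Hcd Hf.
  assert (Hmin : forall x, exists y0, c <= y0 <= d /\ forall y, c <= y <= d -> f x y0 <= f x y).
  { intros x. destruct (continuity_ab_min (f x) c d Hcd) as [y0 [Hy0 Hin]].
    - intros y _. now apply continuity_2d_section.
    - now exists y0. }
  set (ymin := fun x => proj1_sig (constructive_indefinite_description _ (Hmin x))).
  assert (Hymin : forall x, c <= ymin x <= d /\ forall y, c <= y <= d -> f x (ymin x) <= f x y)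
    by (intros x; exact (proj2_sig (constructive_indefinite_description _ (Hmin x)))).
  assert (Hcont : continuity (fun x => f x (ymin x))).
  { intros x eps Heps.
    destruct (uniform_continuity_2d_1d' f c d x (fun y _ => Hf x y) (mkposreal eps Heps))
      as [delta Hdelta].
    exists delta. split; [apply cond_pos |]. intros z [_ Hz].
    unfold dist in *; simpl in *; unfold Rdist in *. apply Rabs_def2 in Hz.
    assert (Hunif : forall y, c <= y <= d -> Rabs (f z y - f x y) < eps).
    { intros y Hy. assert (Hd := cond_pos delta). apply Hdelta; try lra.
      now rewrite Rminus_diag, Rabs_R0. }
    destruct (Hymin x) as [Hx Hxmin], (Hymin z) as [Hz' Hzmin].
    assert (Hux := Rabs_def2 _ _ (Hunif _ Hx)). assert (Huz := Rabs_def2 _ _ (Hunif _ Hz')).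
    specialize (Hxmin _ Hz'). specialize (Hzmin _ Hx). apply Rabs_def1; lra. }
  destruct (continuity_ab_min _ a b Hab (fun x _ => Hcont x)) as [x0 [Hx0 Hin]].
  exists x0, (ymin x0). split; [exact Hin | split; [apply Hymin |]].
  intros x y Hx Hy. apply Rle_trans with (1 := Hx0 x Hx). now apply Hymin.
Qed.

(** * Periodic functions *)

Definition periodic (L : R) (f : R -> R) : Prop := forall s, f (s + L) = f s.

Lemma periodic_IZR (L : R) (f : R -> R) :
  periodic L f -> forall (k : Z) s, f (s + IZR k * L) = f s.
Proof.
  intros H.
  assert (Hnat : forall n s, f (s + INR n * L) = f s).
  { induction n as [| n IH]; intros s.
    - f_equal. simpl. ring.
    - rewrite <- (IH s), <- (H (s + INR n * L)). f_equal. rewrite S_INR. ring. }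
  intros k s. destruct (Z.le_gt_cases 0 k) as [h | h].
  - rewrite <- (Z2Nat.id k h), <- INR_IZR_INZ. apply Hnat.
  - rewrite <- (Hnat (Z.to_nat (- k)) (s + IZR k * L)). f_equal.
    rewrite INR_IZR_INZ, Z2Nat.id by lia. rewrite opp_IZR. ring.
Qed.

Lemma period_reduce (L s : R) : 0 < L -> exists k : Z, 0 <= s + IZR k * L < L.
Proof.
  intros HL. exists (- Int_part (s / L))%Z.
  destruct (base_Int_part (s / L)) as [h1 h2]. rewrite opp_IZR.
  assert (E : s = s / L * L) by (field; lra).
  split; rewrite E at 1; nra.
Qed.

Lemma periodic_min (L : R) (f : R -> R) :
  0 < L -> periodic L f -> continuity f -> exists s0, forall s, f s0 <= f s.
Proof.
  intros HL Hper Hf.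
  destruct (continuity_ab_min f 0 L) as [s0 [Hs0 _]]; [lra | intros; apply Hf |].
  exists s0. intros s. destruct (period_reduce L s HL) as [k Hk].
  rewrite <- (periodic_IZR L f Hper k s). apply Hs0. lra.
Qed.

Lemma periodic_bounded (L : R) (f : R -> R) :
  0 < L -> periodic L f -> continuity f -> exists K, forall s, Rabs (f s) <= K.
Proof.
  intros HL Hper Hf.
  destruct (periodic_min L (fun s => - Rabs (f s))) as [s0 Hs0].
  - exact HL.
  - intros s. now rewrite Hper.
  - reg.
  - exists (Rabs (f s0)). intros s. specialize (Hs0 s). lra.
Qed.

Lemma is_derive_periodic (L : R) (f df : R -> R) :
  (forall s, is_derive f s (df s)) -> periodic L f -> periodic L df.
Proof.
  intros Hf Hper s. rewrite <- (is_derive_unique f s (df s)) by apply Hf.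
  symmetry. apply is_derive_unique, (is_derive_ext (fun t => f (t + L))); [exact Hper |].
  replace (df (s + L)) with (1 * df (s + L)) by ring.
  apply (is_derive_comp f (fun t => t + L) s); [apply Hf |].
  auto_derive; [exact I | reflexivity].
Qed.

Lemma is_RInt_periodic_derive (L : R) (f df : R -> R) :
  (forall s, is_derive f s (df s)) -> continuity df -> periodic L f -> is_RInt df 0 L 0.
Proof.
  intros Hf Hdf Hper. rewrite <- (Rminus_diag (f 0)) at 2.
  rewrite <- (Hper 0) at 1. rewrite Rplus_0_l.
  now apply is_RInt_derive_continuity.
Qed.

Lemma RInt_periodic (L c : R) (f : R -> R) :
  continuity f -> periodic L f -> RInt f c (c + L) = RInt f 0 L.
Proof.
  intros Hf Hper.
  assert (Hex : forall a b, ex_RInt f a b)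
    by (intros a b; exists (RInt f a b); now apply is_RInt_continuity).
  assert (Hshift : RInt f L (c + L) = RInt f 0 c).
  { transitivity (RInt f (1 * 0 + L) (1 * c + L)); [f_equal; ring |].
    rewrite <- (RInt_comp_lin f 1 L 0 c) by apply Hex. apply RInt_ext.
    intros s _. rewrite Hper. change (1 * f (1 * s) = f s). now rewrite !Rmult_1_l. }
  rewrite <- (RInt_Chasles f c L (c + L)), Hshift by apply Hex.
  rewrite <- (RInt_Chasles f 0 c L) by apply Hex.
  apply Rplus_comm.
Qed.

(** * The second variation of the column *)

Lemma smooth_is_derive (f : R -> R) (n : nat) (x : R) :
  smooth f -> is_derive (nDer n f) x (nDer (S n) f x).
Proof. intros H. apply is_derive_Reals, H. Qed.

Lemma smooth_continuity (f : R -> R) (n : nat) : smooth f -> continuity (nDer n f).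
Proof.
  intros H. apply (is_derive_continuity _ (nDer (S n) f)). intros x. now apply smooth_is_derive.
Qed.

Lemma nDer_Der (n : nat) (f : R -> R) : nDer n (Der f) = nDer (S n) f.
Proof. induction n as [| n IH]; [reflexivity |]. simpl in *. now rewrite IH. Qed.

Lemma smooth_Der (f : R -> R) : smooth f -> smooth (Der f).
Proof. intros H n x. rewrite !nDer_Der. apply H. Qed.

Lemma is_derive_sin_phase (w : R) (n : nat) (t : R) :
  is_derive (fun t => w ^ n * sin (w * t + INR n * (PI / 2))) t
    (w ^ S n * sin (w * t + INR (S n) * (PI / 2))).
Proof.
  replace (w * t + INR (S n) * (PI / 2)) with (PI / 2 + (w * t + INR n * (PI / 2)))
    by (rewrite S_INR; ring).
  rewrite <- cos_sin. auto_derive; [exact I | simpl; ring].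
Qed.

Lemma nDer_sin (w : R) (n : nat) :
  nDer n (fun t => sin (w * t)) = fun t => w ^ n * sin (w * t + INR n * (PI / 2)).
Proof.
  induction n as [| n IH]; apply functional_extensionality; intros t.
  - simpl. rewrite Rmult_0_l, Rplus_0_r. ring.
  - change (nDer (S n) (fun t => sin (w * t))) with (Der (nDer n (fun t => sin (w * t)))).
    rewrite IH. apply Der_unique, is_derive_sin_phase.
Qed.

Lemma smooth_sin (w : R) : smooth (fun t => sin (w * t)).
Proof. intros n t. rewrite !nDer_sin. apply is_derive_Reals, is_derive_sin_phase. Qed.

Lemma pder_prod (f g : R -> R) (w : list bool) : smooth f -> smooth g ->
  pder w (fun t s => f t * g s) =
  fun t s => nDer (length (filter (fun b => b) w)) f t * nDer (length (filter negb w)) g s.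
Proof.
  intros Hf Hg. induction w as [| b w IH]; [reflexivity |].
  simpl pder. rewrite IH.
  apply functional_extensionality; intros t. apply functional_extensionality; intros s.
  destruct b; simpl length; apply Der_unique.
  - apply is_derive_Rmult_const_r. now apply smooth_is_derive.
  - apply (is_derive_scal (nDer _ g)). now apply smooth_is_derive.
Qed.

Lemma smooth2_prod (f g : R -> R) : smooth f -> smooth g -> smooth2 (fun t s => f t * g s).
Proof.
  intros Hf Hg w. split.
  - rewrite pder_prod by assumption. intros t s eps Heps.
    set (F := nDer _ f). set (G := nDer _ g).
    assert (HF : continuity F) by now apply smooth_continuity.
    assert (HG : continuity G) by now apply smooth_continuity.
    assert (Hcont : continuity_2d_pt (fun t s => F t * G s) t s) by continuity_2d.
    destruct (Hcont (mkposreal eps Heps)) as [d Hd].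
    exists d. split; [apply cond_pos | intros t' s' h1 h2; now apply Hd].
  - intros t s. rewrite !pder_prod by assumption.
    split; apply is_derive_Reals; simpl length.
    + apply is_derive_Rmult_const_r. now apply smooth_is_derive.
    + apply (is_derive_scal (nDer _ g)). now apply smooth_is_derive.
Qed.

Lemma Lap_sin_prod (w : R) (g : R -> R) (t s : R) : smooth g ->
  Lap (fun t s => sin (w * t) * g s) t s = sin (w * t) * (nDer 2 g s - w ^ 2 * g s).
Proof.
  intros Hg. set (u := fun t s => sin (w * t) * g s).
  change (Lap u t s) with (pder (true :: true :: nil) u t s + pder (false :: false :: nil) u t s).
  unfold u. rewrite !(pder_prod (fun t => sin (w * t)) g) by (try apply smooth_sin; assumption).
  cbv [filter length negb]. rewrite nDer_sin.
  replace (w * t + INR 2 * (PI / 2)) with (w * t + PI) by (simpl; lra).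
  rewrite neg_sin. simpl. ring.
Qed.

Lemma is_RInt_sin_sqr (l : R) : 0 < l -> is_RInt (fun t => sin (PI / l * t) ^ 2) 0 l (l / 2).
Proof.
  intros Hl. assert (HP := PI_RGT_0).
  set (F := fun t => t / 2 - sin (2 * (PI / l * t)) / (4 * (PI / l))).
  replace (l / 2) with (F l - F 0).
  - apply is_RInt_derive_continuity; [| reg].
    intros t. unfold F. auto_derive; [exact I |]. rewrite cos_2a_sin. field. split; lra.
  - unfold F. replace (PI / l * l) with PI by (field; lra).
    rewrite sin_2PI, !Rmult_0_r, sin_0. lra.
Qed.

Lemma IntM_prod (f g : R -> R) (L l x y : R) :
  is_RInt f 0 l x -> is_RInt g 0 L y -> IntM L l (fun t s => f t * g s) = x * y.
Proof.
  intros Hf Hg. apply Defs_RInt_unique, (is_RInt_ext (fun s => x * g s)).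
  - intros s _. symmetry. apply Defs_RInt_unique. rewrite (Rmult_comm x).
    apply (is_RInt_ext (fun t => g s * f t)); [intros t _; apply Rmult_comm |].
    exact (is_RInt_scal f 0 l (g s) x Hf).
  - exact (is_RInt_scal g 0 L x y Hg).
Qed.

Section SecondVariation.

Variables (a1 a2 : R -> R) (L l a : R).
Hypotheses (l_pos : 0 < l) (smooth_a1 : smooth a1) (smooth_a2 : smooth a2).

(* [reg] looks up the continuity of the functions that it does not know in the context. *)
Let continuity_a1 : continuity a1 := smooth_continuity a1 0 smooth_a1.
Let continuity_a2 : continuity a2 := smooth_continuity a2 0 smooth_a2.
Let continuity_Der_a1 : continuity (Der a1) := smooth_continuity a1 1 smooth_a1.
Let continuity_Der_a2 : continuity (Der a2) := smooth_continuity a2 1 smooth_a2.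
Let continuity_Der_Der_a1 : continuity (Der (Der a1)) := smooth_continuity a1 2 smooth_a1.
Let continuity_Der_Der_a2 : continuity (Der (Der a2)) := smooth_continuity a2 2 smooth_a2.

Definition column_potential (s : R) : R :=
  kappa a1 a2 s ^ 2 + 2 * a * (a1 s * Der a2 s - a2 s * Der a1 s).

(* The integrand of [- Phi] at [sin (PI / l * t) * g s], divided by [sin (PI / l * t) ^ 2] *)
Definition column_form (g : R -> R) (s : R) : R :=
  g s * (nDer 2 g s + (column_potential s - (PI / l) ^ 2) * g s).

Lemma column_form_continuity (g : R -> R) : smooth g -> continuity (column_form g).
Proof.
  intros Hg.
  assert (Cg : continuity g) by exact (smooth_continuity g 0 Hg).
  assert (Cddg : continuity (Der (Der g))) by exact (smooth_continuity g 2 Hg).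
  unfold column_form, column_potential, kappa. simpl. reg.
Qed.

Lemma Phi_sin_prod (g : R -> R) : smooth g ->
  Phi a1 a2 L l a (fun t s => sin (PI / l * t) * g s) = - (l / 2 * RInt (column_form g) 0 L).
Proof.
  intros Hg. unfold Phi. f_equal.
  rewrite <- (IntM_prod (fun t => sin (PI / l * t) ^ 2) (column_form g) L l (l / 2)).
  - f_equal. apply functional_extensionality; intros t. apply functional_extensionality; intros s.
    rewrite Lap_sin_prod by exact Hg.
    unfold column_form, column_potential, sigma2, hM, x3, N3, NM, xM, alpha', cross, dot3, E3.
    simpl. ring.
  - now apply is_RInt_sin_sqr.
  - now apply is_RInt_continuity, column_form_continuity.
Qed.

Lemma stable_column_form_Der (f : R -> R) :
  stable a1 a2 L l a -> smooth f -> periodic L f -> RInt (column_form (Der f)) 0 L <= 0.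
Proof.
  intros Hst Hf Hper.
  assert (Hd : forall s, is_derive f s (Der f s)) by exact (fun s => smooth_is_derive f 0 s Hf).
  assert (HPhi : Phi a1 a2 L l a (fun t s => sin (PI / l * t) * Der f s) >= 0).
  { apply Hst.
    - apply (smooth2_prod (fun t => sin (PI / l * t))); [apply smooth_sin | now apply smooth_Der].
    - intros t s. f_equal. now apply (is_derive_periodic L f).
    - intros s. rewrite Rmult_0_r, sin_0.
      replace (PI / l * l) with PI by (field; lra). rewrite sin_PI. lra.
    - set (S := fun t => sin (PI / l * t)).
      change (IntM L l (fun t s => S t * Der f s) = 0).
      rewrite (IntM_prod S (Der f) L l (RInt S 0 l) 0).
      + apply Rmult_0_r.
      + apply is_RInt_continuity. unfold S. reg.
      + exact (is_RInt_periodic_derive L f _ Hd (smooth_continuity f 1 Hf) Hper). }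
  rewrite Phi_sin_prod in HPhi by now apply smooth_Der. nra.
Qed.

Hypothesis unit_velocity : forall s, Der a1 s ^ 2 + Der a2 s ^ 2 = 1.

Lemma velocity_dot_acceleration (s : R) : Der a1 s * nDer 2 a1 s + Der a2 s * nDer 2 a2 s = 0.
Proof.
  cut (2 * (Der a1 s * nDer 2 a1 s + Der a2 s * nDer 2 a2 s) = 0); [lra |].
  apply (is_derive_constant (fun s => Der a1 s ^ 2 + Der a2 s ^ 2) 1 s); [exact unit_velocity |].
  evar_last.
  - apply (is_derive_plus (fun s => Der a1 s ^ 2) (fun s => Der a2 s ^ 2)); apply is_derive_pow.
    + exact (smooth_is_derive a1 1 s smooth_a1).
    + exact (smooth_is_derive a2 1 s smooth_a2).
  - unfold plus; simpl. ring.
Qed.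

Lemma velocity_dot_jerk (s : R) :
  Der a1 s * nDer 3 a1 s + Der a2 s * nDer 3 a2 s = - (nDer 2 a1 s ^ 2 + nDer 2 a2 s ^ 2).
Proof.
  cut (nDer 2 a1 s * nDer 2 a1 s + Der a1 s * nDer 3 a1 s
       + (nDer 2 a2 s * nDer 2 a2 s + Der a2 s * nDer 3 a2 s) = 0); [lra |].
  apply (is_derive_constant (fun s => Der a1 s * nDer 2 a1 s + Der a2 s * nDer 2 a2 s) 0 s);
    [exact velocity_dot_acceleration |].
  apply (is_derive_plus (fun s => Der a1 s * nDer 2 a1 s) (fun s => Der a2 s * nDer 2 a2 s)).
  - exact (is_derive_Rmult _ _ _ _ _ (smooth_is_derive a1 1 s smooth_a1)
             (smooth_is_derive a1 2 s smooth_a1)).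
  - exact (is_derive_Rmult _ _ _ _ _ (smooth_is_derive a2 1 s smooth_a2)
             (smooth_is_derive a2 2 s smooth_a2)).
Qed.

Lemma kappa_sqr (s : R) : kappa a1 a2 s ^ 2 = nDer 2 a1 s ^ 2 + nDer 2 a2 s ^ 2.
Proof.
  transitivity ((nDer 2 a1 s ^ 2 + nDer 2 a2 s ^ 2) * (Der a1 s ^ 2 + Der a2 s ^ 2)
                - (Der a1 s * nDer 2 a1 s + Der a2 s * nDer 2 a2 s) ^ 2).
  - unfold kappa. ring.
  - rewrite unit_velocity, velocity_dot_acceleration. ring.
Qed.

(* [<alpha', alpha'''> = - kappa^2] cancels the term [|sigma|^2] of the Jacobi operator. *)
Lemma column_form_velocity_sum (s : R) :
  column_form (Der a1) s + column_form (Der a2) s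
  = 2 * a * (a1 s * Der a2 s - a2 s * Der a1 s) - (PI / l) ^ 2.
Proof.
  unfold column_form. rewrite !nDer_Der.
  transitivity ((Der a1 s * nDer 3 a1 s + Der a2 s * nDer 3 a2 s)
    + (column_potential s - (PI / l) ^ 2) * (Der a1 s ^ 2 + Der a2 s ^ 2)); [ring |].
  rewrite unit_velocity, velocity_dot_jerk, <- kappa_sqr. unfold column_potential. ring.
Qed.

Lemma stable_column_bound :
  periodic L a1 -> periodic L a2 -> stable a1 a2 L l a ->
  2 * a * RInt (fun s => a1 s * Der a2 s - a2 s * Der a1 s) 0 L <= (PI / l) ^ 2 * L.
Proof.
  intros Hp1 Hp2 Hst.
  assert (Hform1 := stable_column_form_Der a1 Hst smooth_a1 Hp1).
  assert (Hform2 := stable_column_form_Der a2 Hst smooth_a2 Hp2).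
  assert (Cform1 := column_form_continuity _ (smooth_Der _ smooth_a1)).
  assert (Cform2 := column_form_continuity _ (smooth_Der _ smooth_a2)).
  assert (Iform1 := is_RInt_continuity _ 0 L Cform1).
  assert (Iform2 := is_RInt_continuity _ 0 L Cform2).
  assert (Iw : is_RInt (fun s => a1 s * Der a2 s - a2 s * Der a1 s) 0 L
                 (RInt (fun s => a1 s * Der a2 s - a2 s * Der a1 s) 0 L))
    by (apply is_RInt_continuity; reg).
  set (w := RInt (fun s => a1 s * Der a2 s - a2 s * Der a1 s) 0 L) in *.
  assert (Isum : is_RInt (fun s => column_form (Der a1) s + column_form (Der a2) s) 0 L
                   (2 * a * w - L * (PI / l) ^ 2)).
  { apply (is_RInt_ext (fun s => 2 * a * (a1 s * Der a2 s - a2 s * Der a1 s) - (PI / l) ^ 2)).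
    - intros s _. symmetry. apply column_form_velocity_sum.
    - rewrite <- (Rminus_0_r L) at 2.
      apply (is_RInt_minus (fun s => 2 * a * (a1 s * Der a2 s - a2 s * Der a1 s))).
      + exact (is_RInt_scal _ 0 L (2 * a) w Iw).
      + now apply is_RInt_constant. }
  assert (E : 2 * a * w - L * (PI / l) ^ 2
              = RInt (column_form (Der a1)) 0 L + RInt (column_form (Der a2)) 0 L).
  { rewrite <- (is_RInt_unique _ _ _ _ Isum).
    exact (is_RInt_unique _ _ _ _ (is_RInt_plus _ _ 0 L _ _ Iform1 Iform2)). }
  lra.
Qed.

End SecondVariation.

(** * A bump function and its primitive *)

Lemma is_derive_Rmax0_sqr (x : R) : is_derive (fun y => Rmax 0 y ^ 2) x (2 * Rmax 0 x).
Proof.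
  destruct (Rtotal_order x 0) as [h | [-> | h]].
  - rewrite Rmax_left, Rmult_0_r by lra.
    apply (is_derive_ext_loc (fun _ => 0)); [| exact (is_derive_const 0 x)].
    apply (locally_interval _ x m_infty 0); [exact I | exact h |].
    intros y _ Hy. simpl in Hy. now rewrite Rmax_left, pow_i by (lra || lia).
  - rewrite Rmax_left, Rmult_0_r by lra. apply is_derive_Reals. intros eps Heps.
    exists (mkposreal eps Heps). intros h Hh Heps'. simpl in Heps'.
    rewrite Rplus_0_l, (Rmax_left 0 0) by lra.
    replace ((Rmax 0 h ^ 2 - 0 ^ 2) / h - 0) with (Rmax 0 h ^ 2 / h) by (field; exact Hh).
    apply Rle_lt_trans with (2 := Heps').
    destruct (Rle_lt_dec h 0) as [h0 | h0].
    + rewrite Rmax_left by exact h0. replace (0 ^ 2 / h) with 0 by (field; exact Hh).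
      rewrite Rabs_R0. apply Rabs_pos.
    + rewrite Rmax_right by lra. right. f_equal. field. exact Hh.
  - rewrite Rmax_right by lra.
    apply (is_derive_ext_loc (fun y => y ^ 2)); [| auto_derive; [exact I | ring]].
    apply (locally_interval _ x 0 p_infty); [exact h | exact I |].
    intros y Hy _. simpl in Hy. rewrite Rmax_right by lra. reflexivity.
Qed.

Definition bump (d x : R) : R := 15 / 16 / d * Rmax 0 (1 - (x / d) ^ 2) ^ 2.

Definition bump_deriv (d x : R) : R :=
  15 / 16 / d * (- (2 * (x / d) / d) * (2 * Rmax 0 (1 - (x / d) ^ 2))).

Definition step (d x : R) : R := RInt (bump d) (- d) x.

Lemma is_derive_bump (d x : R) : is_derive (bump d) x (bump_deriv d x).
Proof.
  apply (is_derive_scal (fun x => Rmax 0 (1 - (x / d) ^ 2) ^ 2)).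
  apply (is_derive_comp (fun y => Rmax 0 y ^ 2) (fun x => 1 - (x / d) ^ 2)).
  - apply is_derive_Rmax0_sqr.
  - auto_derive; [exact I | unfold Rdiv; ring].
Qed.

Lemma continuity_bump (d : R) : continuity (bump d).
Proof. apply (is_derive_continuity _ (bump_deriv d)), is_derive_bump. Qed.

Lemma continuity_bump_deriv (d : R) : continuity (bump_deriv d).
Proof. assert (H := continuity_Rmax 0). unfold bump_deriv, Rdiv. reg. Qed.

Lemma is_derive_step (d x : R) : is_derive (step d) x (bump d x).
Proof. apply is_derive_RInt_continuity, continuity_bump. Qed.

Lemma continuity_step (d : R) : continuity (step d).
Proof. apply (is_derive_continuity _ (bump d)), is_derive_step. Qed.

(* The [UnaryDiff] instances are used by [auto_derive]. *)
#[local] Instance UnaryDiff_bump (d : R) : UnaryDiff (bump d) :=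
  {| UnaryDiff_H := is_derive_bump d |}.
#[local] Instance UnaryDiff_step (d : R) : UnaryDiff (step d) :=
  {| UnaryDiff_H := is_derive_step d |}.

Section Bump.

Variable d : R.
Hypothesis d_pos : 0 < d.

Lemma bump_ge0 (x : R) : 0 <= bump d x.
Proof.
  apply Rmult_le_pos; [| apply pow2_ge_0]. apply Rlt_le, Rdiv_lt_0_compat; lra.
Qed.

Lemma bump_outside (x : R) : d <= Rabs x -> bump d x = 0.
Proof.
  intros Hx. unfold bump. rewrite Rmax_left; [ring |].
  assert (H : 1 <= Rabs (x / d)).
  { rewrite Rabs_div, (Rabs_pos_eq d) by lra. apply Rle_div_r; lra. }
  rewrite <- pow2_abs. nra.
Qed.

Lemma bump_inside (x : R) : Rabs x <= d -> bump d x = 15 / 16 / d * (1 - (x / d) ^ 2) ^ 2.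
Proof.
  intros Hx. unfold bump. rewrite Rmax_right; [reflexivity |].
  assert (H : Rabs (x / d) <= 1).
  { rewrite Rabs_div, (Rabs_pos_eq d) by lra. apply Rle_div_l; lra. }
  rewrite <- pow2_abs. assert (Hpos := Rabs_pos (x / d)). nra.
Qed.

Lemma step_left (x : R) : x <= - d -> step d x = 0.
Proof.
  intros Hx. apply is_RInt_unique, is_RInt_vanishing. intros y.
  rewrite Rmax_left by lra. intros [_ Hy]. apply bump_outside. rewrite Rabs_left; lra.
Qed.

Lemma step_right (x : R) : d <= x -> step d x = 1.
Proof.
  intros Hx. apply is_RInt_unique. replace 1 with (1 + 0) by ring.
  apply (is_RInt_Chasles (bump d) (- d) d x).
  - set (P := fun y => 15 / 16 * (y / d - 2 / 3 * (y / d) ^ 3 + 1 / 5 * (y / d) ^ 5)).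
    replace 1 with (P d - P (- d)) by (unfold P; field; lra).
    apply (is_RInt_ext (fun y => 15 / 16 / d * (1 - (y / d) ^ 2) ^ 2)).
    + intros y. rewrite Rmin_left, Rmax_right by lra. intros Hy.
      symmetry. apply bump_inside. apply Rabs_le. lra.
    + apply is_RInt_derive_continuity; [| unfold Rdiv; reg].
      intros y. unfold P. auto_derive; [exact I | field; lra].
  - apply is_RInt_vanishing. intros y. rewrite Rmin_left by lra. intros [Hy _].
    apply bump_outside. rewrite Rabs_pos_eq; lra.
Qed.

Lemma is_RInt_bump_reflected (M x : R) :
  d <= x + M -> x - M <= - d -> is_RInt (fun y => bump d (x - y)) (- M) M 1.
Proof.
  intros Hleft Hright. replace 1 with (- step d (x - M) - - step d (x - - M))
    by (rewrite step_left, step_right; lra).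
  apply (is_RInt_derive_continuity (fun y => - step d (x - y))).
  - intros y. auto_derive; [exact I | unfold Rminus; ring].
  - assert (H := continuity_bump d). reg.
Qed.

Lemma is_RInt_step_reflected (M : R) :
  exists c, forall x, d <= x + M -> x - M <= - d ->
    is_RInt (fun y => step d (x - y)) (- M) M (x + c).
Proof.
  set (F := fun x => RInt (step d) (- d) x).
  assert (HF : forall x, is_derive F x (step d x))
    by exact (fun x => is_derive_RInt_continuity _ _ x (continuity_step d)).
  assert (F_left : forall x, x <= - d -> F x = 0).
  { intros x Hx. apply is_RInt_unique, is_RInt_vanishing. intros y.
    rewrite Rmax_left by lra. intros [_ Hy]. apply step_left. lra. }
  assert (F_right : forall x, d <= x -> F x = F d + (x - d)).
  { intros x Hx. apply is_RInt_unique, (is_RInt_Chasles (step d) (- d) d x).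
    - apply is_RInt_continuity, continuity_step.
    - rewrite <- (Rmult_1_r (x - d)). apply is_RInt_constant. intros y.
      rewrite Rmin_left by lra. intros [Hy _]. apply step_right. lra. }
  exists (F d + M - d). intros x Hleft Hright.
  replace (x + (F d + M - d)) with (- F (x - M) - - F (x - - M))
    by (rewrite F_left, F_right; lra).
  apply (is_RInt_derive_continuity (fun y => - F (x - y))).
  - intros y. rewrite <- (Ropp_involutive (step d (x - y))).
    apply (is_derive_opp (fun y => F (x - y))).
    replace (- step d (x - y)) with (- (1) * step d (x - y)) by ring.
    apply (is_derive_comp F (fun y => x - y)); [apply HF |].
    auto_derive; [exact I | ring].
  - assert (H := continuity_step d). reg.
Qed.

End Bump.

(** * Iterated integrals of indicators of rectangles *)

Definition is_RInt2 (f : R -> R -> R) (a b c d v : R) : Prop :=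
  exists V, (forall x, is_RInt (f x) c d (V x)) /\ is_RInt V a b v.

Lemma is_RInt2_plus (f g : R -> R -> R) (a b c d v w : R) :
  is_RInt2 f a b c d v -> is_RInt2 g a b c d w ->
  is_RInt2 (fun x y => f x y + g x y) a b c d (v + w).
Proof.
  intros [V [HV Hv]] [W [HW Hw]]. exists (fun x => V x + W x). split.
  - intros x. exact (is_RInt_plus _ _ _ _ _ _ (HV x) (HW x)).
  - exact (is_RInt_plus _ _ _ _ _ _ Hv Hw).
Qed.

Lemma is_RInt2_prod (f g : R -> R) (a b c d v w : R) :
  is_RInt f a b v -> is_RInt g c d w -> is_RInt2 (fun x y => f x * g y) a b c d (v * w).
Proof.
  intros Hf Hg. exists (fun x => f x * w). split.
  - intros x. exact (is_RInt_scal g c d (f x) w Hg).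
  - rewrite Rmult_comm. apply (is_RInt_ext (fun x => w * f x)); [intros x _; apply Rmult_comm |].
    exact (is_RInt_scal f a b w v Hf).
Qed.

Lemma is_RInt2_le (f g : R -> R -> R) (a b c d v w : R) :
  a <= b -> c <= d -> is_RInt2 f a b c d v -> is_RInt2 g a b c d w ->
  (forall x y, f x y <= g x y) -> v <= w.
Proof.
  intros Hab Hcd [V [HV Hv]] [W [HW Hw]] Hfg.
  apply (is_RInt_le V W a b v w Hab Hv Hw). intros x _.
  apply (is_RInt_le (f x) (g x) c d _ _ Hcd (HV x) (HW x)). auto.
Qed.

(* Half-open intervals, so that rectangles with disjoint interiors have disjoint indicators *)
Definition indicator (u v x : R) : R :=
  if Rle_dec u x then if Rlt_dec x v then 1 else 0 else 0.

Lemma indicator_cases (u v x : R) :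
  indicator u v x = 0 \/ (indicator u v x = 1 /\ u <= x < v).
Proof. unfold indicator. destruct (Rle_dec u x); [destruct (Rlt_dec x v) |]; auto. Qed.

Lemma is_RInt_indicator (a b u v : R) : a <= u -> u <= v -> v <= b ->
  is_RInt (indicator u v) a b (v - u).
Proof.
  intros Hau Huv Hvb.
  replace (v - u) with ((u - a) * 0 + ((v - u) * 1 + (b - v) * 0)) by ring.
  apply (is_RInt_Chasles (indicator u v) a u b);
    [| apply (is_RInt_Chasles (indicator u v) u v b)];
    apply is_RInt_constant; intros x; rewrite Rmin_left, Rmax_right by lra; intros Hx;
    unfold indicator; destruct (Rle_dec u x); try destruct (Rlt_dec x v); lra.
Qed.

Definition rect_indicator (r : rect) (x y : R) : R :=
  let '(x0, x1, y0, y1) := r in indicator x0 x1 x * indicator y0 y1 y.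

Definition in_rect (r : rect) (x y : R) : Prop :=
  let '(x0, x1, y0, y1) := r in x0 <= x <= x1 /\ y0 <= y <= y1.

Definition rect_in_square (M : R) (r : rect) : Prop :=
  let '(x0, x1, y0, y1) := r in
  - M <= x0 /\ x0 <= x1 /\ x1 <= M /\ - M <= y0 /\ y0 <= y1 /\ y1 <= M.

Definition rects_indicator (rs : list rect) (x y : R) : R :=
  fold_right (fun r acc => rect_indicator r x y + acc) 0 rs.

Definition rects_area (rs : list rect) : R := fold_right (fun r acc => rect_area r + acc) 0 rs.

Lemma rect_indicator_cases (r : rect) (x y : R) :
  rect_indicator r x y = 0 \/ (rect_indicator r x y = 1 /\ in_rect r x y).
Proof.
  destruct r as [[[x0 x1] y0] y1]. simpl.
  destruct (indicator_cases x0 x1 x) as [-> | [-> Hx]]; [left; ring |].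
  destruct (indicator_cases y0 y1 y) as [-> | [-> Hy]]; [left; ring | right; lra].
Qed.

Lemma rect_indicator_disj (r r' : rect) (x y : R) :
  rect_disj r r' -> rect_indicator r x y = 1 -> rect_indicator r' x y = 0.
Proof.
  destruct r as [[[x0 x1] y0] y1], r' as [[[x0' x1'] y0'] y1']. simpl. intros Hdisj Hr.
  destruct (indicator_cases x0 x1 x) as [E | [_ Hx]]; [rewrite E in Hr; lra |].
  destruct (indicator_cases y0 y1 y) as [E | [_ Hy]]; [rewrite E in Hr; lra |].
  destruct (indicator_cases x0' x1' x) as [-> | [_ Hx']]; [ring |].
  destruct (indicator_cases y0' y1' y) as [-> | [_ Hy']]; [ring |].
  destruct Hdisj as [h | [h | [h | h]]]; lra.
Qed.

Lemma rects_indicator_cases (rs : list rect) (x y : R) : rects_disj rs ->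
  rects_indicator rs x y = 0 \/
  (rects_indicator rs x y = 1 /\ exists r, In r rs /\ in_rect r x y).
Proof.
  induction rs as [| r rs IH]; intros H; [now left |].
  destruct H as [Hdisj H]. simpl.
  destruct (rect_indicator_cases r x y) as [E | [E Hin]]; rewrite E.
  - rewrite Rplus_0_l. destruct (IH H) as [h | [h (r' & h1 & h2)]]; [now left | right].
    split; [exact h |]. exists r'. auto.
  - right. split; [| exists r; auto].
    replace (rects_indicator rs x y) with 0; [ring |]. clear IH H.
    induction Hdisj as [| r' rs Hr' _ IH]; [reflexivity |].
    simpl. rewrite <- IH, (rect_indicator_disj r r') by assumption. ring.
Qed.

Lemma is_RInt2_rects_indicator (rs : list rect) (M : R) :
  List.Forall (rect_in_square M) rs ->
  is_RInt2 (rects_indicator rs) (- M) M (- M) M (rects_area rs).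
Proof.
  induction 1 as [| r rs Hr _ IH].
  - exists (fun _ => 0). split; [intros x |]; now apply is_RInt_vanishing.
  - apply (is_RInt2_plus (rect_indicator r)); [| exact IH].
    destruct r as [[[x0 x1] y0] y1]. simpl in Hr.
    apply is_RInt2_prod; apply is_RInt_indicator; lra.
Qed.

Lemma rects_in_square (Om : R * R -> Prop) (rs : list rect) (M0 : R) :
  List.Forall (rect_ok Om) rs -> exists M, M0 <= M /\ List.Forall (rect_in_square M) rs.
Proof.
  induction 1 as [| r rs Hr _ [M [HM HF]]].
  - exists M0. split; [lra | constructor].
  - destruct r as [[[x0 x1] y0] y1]. simpl in Hr.
    set (M' := Rmax M (Rmax (Rmax (- x0) x1) (Rmax (- y0) y1))).
    assert (HM' : M <= M' /\ - M' <= x0 /\ x1 <= M' /\ - M' <= y0 /\ y1 <= M')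
      by (unfold M', Rmax; repeat destruct (Rle_dec _ _); lra).
    exists M'. split; [lra |]. constructor; [simpl; lra |].
    eapply List.Forall_impl; [| exact HF]. intros [[[u0 u1] v0] v1]. simpl. lra.
Qed.

(** * Geometry of a unit speed closed curve *)

Definition dist2 (p q : R * R) : R := (fst p - fst q) ^ 2 + (snd p - snd q) ^ 2.

Lemma sum_sqr_le0 (x y : R) : x ^ 2 + y ^ 2 <= 0 -> x = 0 /\ y = 0.
Proof. intros H. split; nra. Qed.

Lemma unit_vector_bound (x y : R) : x ^ 2 + y ^ 2 = 1 -> Rabs x <= 1 /\ Rabs y <= 1.
Proof. intros H. split; apply Rabs_le; nra. Qed.

Section ClosedCurve.

Variables (L : R) (a1 a2 b1 b2 c1 c2 : R -> R).

Record unit_speed_curve : Prop := {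
  period_pos : 0 < L;
  periodic_a1 : periodic L a1;
  periodic_a2 : periodic L a2;
  is_derive_a1 : forall s, is_derive a1 s (b1 s);
  is_derive_a2 : forall s, is_derive a2 s (b2 s);
  is_derive_b1 : forall s, is_derive b1 s (c1 s);
  is_derive_b2 : forall s, is_derive b2 s (c2 s);
  continuity_c1 : continuity c1;
  continuity_c2 : continuity c2;
  unit_speed : forall s, b1 s ^ 2 + b2 s ^ 2 = 1;
  simple_closed : forall s s', 0 <= s < L -> 0 <= s' < L ->
    a1 s = a1 s' -> a2 s = a2 s' -> s = s' }.

Hypothesis C : unit_speed_curve.

Let Ca1 : continuity a1 := is_derive_continuity a1 b1 (is_derive_a1 C).
Let Ca2 : continuity a2 := is_derive_continuity a2 b2 (is_derive_a2 C).
Let Cb1 : continuity b1 := is_derive_continuity b1 c1 (is_derive_b1 C).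
Let Cb2 : continuity b2 := is_derive_continuity b2 c2 (is_derive_b2 C).
Let Cc1 : continuity c1 := continuity_c1 C.
Let Cc2 : continuity c2 := continuity_c2 C.

#[local] Instance UnaryDiff_a1 : UnaryDiff a1 := {| UnaryDiff_H := is_derive_a1 C |}.
#[local] Instance UnaryDiff_a2 : UnaryDiff a2 := {| UnaryDiff_H := is_derive_a2 C |}.
#[local] Instance UnaryDiff_b1 : UnaryDiff b1 := {| UnaryDiff_H := is_derive_b1 C |}.
#[local] Instance UnaryDiff_b2 : UnaryDiff b2 := {| UnaryDiff_H := is_derive_b2 C |}.

Definition trace (s : R) : R * R := (a1 s, a2 s).

Definition offset (r s : R) : R * R := (a1 s - r * b2 s, a2 s + r * b1 s).

Definition far (r : R) (p : R * R) : Prop := forall s, r ^ 2 <= dist2 (trace s) p.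

Definition tangent_dot (s s' : R) : R := b1 s * b1 s' + b2 s * b2 s'.

Definition chord_tangential (s s' : R) : R := (a1 s' - a1 s) * b1 s + (a2 s' - a2 s) * b2 s.

Definition chord_normal (s s' : R) : R := - (a1 s' - a1 s) * b2 s + (a2 s' - a2 s) * b1 s.

Lemma periodic_b1 : periodic L b1.
Proof. exact (is_derive_periodic L a1 b1 (is_derive_a1 C) (periodic_a1 C)). Qed.

Lemma periodic_b2 : periodic L b2.
Proof. exact (is_derive_periodic L a2 b2 (is_derive_a2 C) (periodic_a2 C)). Qed.

Lemma trace_IZR (k : Z) (s : R) : trace (s + IZR k * L) = trace s.
Proof.
  unfold trace.
  now rewrite (periodic_IZR L a1 (periodic_a1 C)), (periodic_IZR L a2 (periodic_a2 C)).
Qed.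

Lemma tangent_dot_IZR (k : Z) (s s' : R) : tangent_dot s (s' + IZR k * L) = tangent_dot s s'.
Proof.
  unfold tangent_dot.
  now rewrite (periodic_IZR L b1 periodic_b1), (periodic_IZR L b2 periodic_b2).
Qed.

Lemma chord_normal_IZR (k : Z) (s s' : R) : chord_normal s (s' + IZR k * L) = chord_normal s s'.
Proof.
  unfold chord_normal.
  now rewrite (periodic_IZR L a1 (periodic_a1 C)), (periodic_IZR L a2 (periodic_a2 C)).
Qed.

Lemma chord_pythagoras (s s' : R) :
  dist2 (trace s') (trace s) = chord_tangential s s' ^ 2 + chord_normal s s' ^ 2.
Proof.
  unfold dist2, chord_tangential, chord_normal, trace; cbn [fst snd].
  transitivity (((a1 s' - a1 s) ^ 2 + (a2 s' - a2 s) ^ 2) * (b1 s ^ 2 + b2 s ^ 2)); [| ring].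
  rewrite (unit_speed C). ring.
Qed.

Lemma dist2_offset (r s s' : R) :
  dist2 (trace s') (offset r s) = dist2 (trace s') (trace s) - 2 * r * chord_normal s s' + r ^ 2.
Proof.
  unfold dist2, chord_normal, offset, trace; cbn [fst snd].
  rewrite <- (Rmult_1_r (r ^ 2)), <- (unit_speed C s). ring.
Qed.

Lemma acceleration_bound :
  exists K, 0 < K /\ forall s u v, u ^ 2 + v ^ 2 = 1 -> Rabs (c1 s * u + c2 s * v) <= K.
Proof.
  assert (Pc1 := is_derive_periodic L b1 c1 (is_derive_b1 C) periodic_b1).
  assert (Pc2 := is_derive_periodic L b2 c2 (is_derive_b2 C) periodic_b2).
  destruct (periodic_bounded L c1 (period_pos C) Pc1 Cc1) as [K1 HK1].
  destruct (periodic_bounded L c2 (period_pos C) Pc2 Cc2) as [K2 HK2].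
  exists (K1 + K2 + 1). split.
  - assert (HK1pos := Rle_trans _ _ _ (Rabs_pos _) (HK1 0)).
    assert (HK2pos := Rle_trans _ _ _ (Rabs_pos _) (HK2 0)). lra.
  - intros s u v Huv. destruct (unit_vector_bound u v Huv) as [Hu Hv].
    apply Rle_trans with (1 := Rabs_triang _ _). rewrite !Rabs_mult.
    specialize (HK1 s). specialize (HK2 s).
    assert (Hc1 := Rabs_pos (c1 s)). assert (Hc2 := Rabs_pos (c2 s)). nra.
Qed.

Lemma near_tangent :
  exists eta, 0 < eta /\ forall s s', Rabs (s' - s) <= eta -> 1 / 2 <= tangent_dot s s'.
Proof.
  destruct acceleration_bound as [K [HK Hacc]].
  exists (/ (2 * K)). split; [apply Rinv_0_lt_compat; lra |]. intros s s' Hs.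
  assert (Hlip : Rabs (tangent_dot s s' - tangent_dot s s) <= K * Rabs (s' - s)).
  { apply (lipschitz_of_derive_bound (tangent_dot s) (fun z => c1 z * b1 s + c2 z * b2 s)).
    - intros z. unfold tangent_dot. auto_derive; [easy | ring].
    - intros z. apply Hacc, (unit_speed C). }
  assert (Hself : tangent_dot s s = 1) by (unfold tangent_dot; rewrite <- (unit_speed C s); ring).
  assert (Hvar : K * Rabs (s' - s) <= 1 / 2).
  { replace (1 / 2) with (K * / (2 * K)) by (field; lra). apply Rmult_le_compat_l; lra. }
  apply Rabs_le_between in Hlip. lra.
Qed.

Lemma chord_tangential_mean_value (s s' : R) :
  exists z, Rabs (z - s) <= Rabs (s' - s) /\ chord_tangential s s' = tangent_dot s z * (s' - s).
Proof.
  destruct (MVT_gen (chord_tangential s) s s' (tangent_dot s)) as [z [Hz E]].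
  - intros z _. unfold chord_tangential, tangent_dot. auto_derive; [easy | ring].
  - intros z _. unfold chord_tangential. reg.
  - exists z. split.
    + revert Hz. unfold Rmin, Rmax.
      destruct (Rle_dec s s'); intros; unfold Rabs; repeat destruct (Rcase_abs _); lra.
    + rewrite <- E. unfold chord_tangential. ring.
Qed.

Lemma chord_normal_quadratic (K s s' : R) :
  (forall s u v, u ^ 2 + v ^ 2 = 1 -> Rabs (c1 s * u + c2 s * v) <= K) ->
  Rabs (chord_normal s s') <= K * (s' - s) ^ 2.
Proof.
  intros Hacc.
  replace (chord_normal s s')
    with (chord_normal s s' - chord_normal s s - (- b1 s * b2 s + b2 s * b1 s) * (s' - s))
    by (unfold chord_normal; ring).
  apply (taylor1_remainder_bound (chord_normal s) (fun z => - b1 z * b2 s + b2 z * b1 s)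
           (fun z => c1 z * - b2 s + c2 z * b1 s)).
  - intros z. unfold chord_normal. auto_derive; [easy | ring].
  - intros z. auto_derive; [easy | ring].
  - intros z. apply Hacc. rewrite <- (unit_speed C s). ring.
Qed.

Lemma trace_injective (s h : R) : 0 < h < L -> trace (s + h) <> trace s.
Proof.
  intros Hh E. destruct (period_reduce L s (period_pos C)) as [k Hk].
  rewrite <- (trace_IZR k s), <- (trace_IZR k (s + h)) in E.
  set (s0 := s + IZR k * L) in *.
  replace (s + h + IZR k * L) with (s0 + h) in E by (unfold s0; ring).
  destruct (Rlt_le_dec (s0 + h) L) as [Hlt | Hge].
  - injection E as E1 E2.
    assert (H := simple_closed C (s0 + h) s0 ltac:(lra) Hk E1 E2). lra.
  - rewrite <- (trace_IZR (-1) (s0 + h)) in E. injection E as E1 E2.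
    assert (H := simple_closed C (s0 + h + -1 * L) s0 ltac:(lra) Hk E1 E2). lra.
Qed.

Definition chord_bound (eta m : R) : Prop :=
  forall s h, eta <= h <= L - eta -> m ^ 2 <= dist2 (trace (s + h)) (trace s).

Lemma chord_bound_exists (eta : R) : 0 < eta -> exists m, 0 < m /\ chord_bound eta m.
Proof.
  intros Heta. set (f := fun s h => dist2 (trace (s + h)) (trace s)).
  destruct (Rlt_le_dec (L - eta) eta) as [Hempty | Hle].
  { exists 1. split; [lra |]. intros s h Hh. lra. }
  destruct (continuity_2d_rectangle_min f 0 L eta (L - eta)) as (s0 & h0 & Hs0 & Hh0 & Hmin).
  - apply Rlt_le, (period_pos C).
  - exact Hle.
  - intros x y. unfold f, dist2, trace. cbn [fst snd]. continuity_2d.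
  - assert (Hpos : 0 < f s0 h0).
    { destruct (Rle_lt_dec (f s0 h0) 0) as [Hle0 |]; [exfalso | assumption].
      destruct (sum_sqr_le0 _ _ Hle0) as [E1%Rminus_diag_uniq E2%Rminus_diag_uniq].
      apply (trace_injective s0 h0); [lra |]. unfold trace in *. simpl in *. now rewrite E1, E2. }
    exists (sqrt (f s0 h0)). split; [now apply sqrt_lt_R0 |]. intros s h Hh.
    rewrite pow2_sqrt by lra. destruct (period_reduce L s (period_pos C)) as [k Hk].
    rewrite <- (trace_IZR k s), <- (trace_IZR k (s + h)).
    replace (s + h + IZR k * L) with (s + IZR k * L + h) by ring.
    apply Hmin; lra.
Qed.

Lemma near_or_far (eta m : R) : chord_bound eta m -> forall s s',
  (exists k : Z, Rabs (s' + IZR k * L - s) <= eta) \/ m ^ 2 <= dist2 (trace s') (trace s).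
Proof.
  intros Hm s s'. destruct (period_reduce L (s' - s) (period_pos C)) as [k Hk].
  destruct (Rle_lt_dec (s' - s + IZR k * L) eta) as [h1 | h1];
    [| destruct (Rle_lt_dec (s' - s + IZR k * L) (L - eta)) as [h2 | h2]].
  - left. exists k. apply Rabs_le. lra.
  - right. rewrite <- (trace_IZR k s').
    replace (s' + IZR k * L) with (s + (s' - s + IZR k * L)) by ring. apply Hm. lra.
  - left. exists (k - 1)%Z. rewrite minus_IZR. apply Rabs_le. lra.
Qed.

Lemma chord_normal_bound :
  exists k, 0 < k /\ forall s s', Rabs (chord_normal s s') <= k * dist2 (trace s') (trace s).
Proof.
  destruct acceleration_bound as [K [HK Hacc]]. destruct near_tangent as [eta [Heta Htan]].
  destruct (chord_bound_exists eta Heta) as [m [Hm Hchord]].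
  assert (Him : 0 < / m) by now apply Rinv_0_lt_compat.
  exists (4 * K + / m). split; [lra |]. intros s s'.
  assert (HT := pow2_ge_0 (chord_tangential s s')). assert (HN := pow2_ge_0 (chord_normal s s')).
  destruct (near_or_far eta m Hchord s s') as [[k Hk] | Hfar].
  - rewrite <- (chord_normal_IZR k s s'), <- (trace_IZR k s').
    set (s'' := s' + IZR k * L) in *.
    assert (Hnorm := chord_normal_quadratic K s s'' Hacc).
    destruct (chord_tangential_mean_value s s'') as [z [Hz Ez]].
    assert (Hz2 := Htan s z ltac:(lra)).
    assert (HT2 : (s'' - s) ^ 2 <= 4 * chord_tangential s s'' ^ 2).
    { rewrite Ez. assert (Hsq := pow2_ge_0 (s'' - s)).
      assert (1 / 4 <= tangent_dot s z ^ 2) by nra. nra. }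
    rewrite chord_pythagoras.
    assert (HT' := pow2_ge_0 (chord_tangential s s'')).
    assert (HN' := pow2_ge_0 (chord_normal s s'')). nra.
  - set (X := dist2 (trace s') (trace s)) in *.
    assert (HX : chord_normal s s' ^ 2 <= X) by (unfold X; rewrite chord_pythagoras; lra).
    assert (HmN : m * Rabs (chord_normal s s') <= X).
    { rewrite <- pow2_abs in HX. assert (Z := pow2_ge_0 (m - Rabs (chord_normal s s'))). nra. }
    apply Rle_trans with (/ m * X).
    + apply (Rmult_le_reg_l m); [exact Hm |].
      rewrite <- Rmult_assoc, Rinv_r, Rmult_1_l by lra. exact HmN.
    + assert (0 <= X) by nra. nra.
Qed.

Lemma far_offset_iff (r s : R) :
  far r (offset r s) <-> forall s', 2 * r * chord_normal s s' <= dist2 (trace s') (trace s).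
Proof.
  split; intros H s'; specialize (H s'); rewrite dist2_offset in *; lra.
Qed.

Lemma far_offset_between (D r s : R) :
  far D (offset D s) -> 0 <= r <= D \/ D <= r <= 0 -> far r (offset r s).
Proof.
  rewrite !far_offset_iff. intros HD Hr s'. specialize (HD s').
  assert (Hpos : 0 <= dist2 (trace s') (trace s))
    by (apply Rplus_le_le_0_compat; apply pow2_ge_0).
  destruct (Rle_lt_dec (chord_normal s s') 0), Hr; nra.
Qed.

Lemma far_offset_small :
  exists rho, 0 < rho /\ forall r s, Rabs r <= rho -> far r (offset r s).
Proof.
  destruct chord_normal_bound as [k [Hk Hnorm]].
  exists (/ (2 * k)). split; [apply Rinv_0_lt_compat; lra |]. intros r s Hr.
  apply far_offset_iff. intros s'. specialize (Hnorm s s').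
  assert (Hpos := Rabs_pos (chord_normal s s')).
  apply Rle_trans with (1 := Rle_abs _). rewrite !Rabs_mult, (Rabs_pos_eq 2) by lra.
  apply Rle_trans with (2 * / (2 * k) * Rabs (chord_normal s s')).
  - apply Rmult_le_compat_r; lra.
  - replace (2 * / (2 * k)) with (/ k) by (field; lra).
    apply (Rmult_le_reg_l k); [exact Hk |]. rewrite <- Rmult_assoc, Rinv_r, Rmult_1_l; lra.
Qed.

Lemma nearest_offset (p : R * R) : exists s D, p = offset D s /\ far D p.
Proof.
  destruct p as [p1 p2]. set (f := fun s => dist2 (trace s) (p1, p2)).
  destruct (periodic_min L f (period_pos C)) as [s Hs].
  - intros s. unfold f, trace. now rewrite (periodic_a1 C), (periodic_a2 C).
  - unfold f, dist2, trace. cbn [fst snd]. reg.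
  - set (X := a1 s - p1). set (Y := a2 s - p2).
    assert (Horth : X * b1 s + Y * b2 s = 0).
    { cut (2 * (X * b1 s + Y * b2 s) = 0); [lra |].
      apply (is_derive_minimum f s); [| exact Hs].
      unfold f, dist2, trace, X, Y. cbn [fst snd]. auto_derive; [easy | ring]. }
    assert (U := unit_speed C s). set (D := X * b2 s - Y * b1 s).
    assert (E1 : X = D * b2 s).
    { transitivity (X * (b1 s ^ 2 + b2 s ^ 2) - (X * b1 s + Y * b2 s) * b1 s).
      - rewrite U, Horth. ring.
      - unfold D. ring. }
    assert (E2 : Y = - D * b1 s).
    { transitivity (Y * (b1 s ^ 2 + b2 s ^ 2) - (X * b1 s + Y * b2 s) * b2 s).
      - rewrite U, Horth. ring.
      - unfold D. ring. }
    exists s, D. split.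
    + unfold offset. rewrite <- E1. replace (D * b1 s) with (- Y) by lra.
      unfold X, Y. f_equal; ring.
    + intros s'. apply Rle_trans with (2 := Hs s').
      replace (f s) with (X ^ 2 + Y ^ 2) by reflexivity.
      rewrite E1, E2. rewrite <- (Rmult_1_r (D ^ 2)), <- U. right. ring.
Qed.

(* The constants leave room for the bumps of radius [d] around the points at distance at most
   [3 * d] from the curve. *)
Record fine_scale (eta d : R) : Prop := {
  fine_pos : 0 < d;
  fine_arc : 2 * d <= eta <= L / 2;
  fine_tangent : forall s s', Rabs (s' - s) <= eta -> 1 / 2 <= tangent_dot s s';
  fine_chord : chord_bound eta (6 * d);
  fine_tube : forall r s, Rabs r <= 3 * d -> far r (offset r s) }.

Lemma fine_scale_exists :
  exists eta d0, 0 < d0 /\ forall d, 0 < d <= d0 -> fine_scale eta d.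
Proof.
  assert (HL := period_pos C).
  destruct near_tangent as [eta0 [Heta0 Htan]]. destruct far_offset_small as [rho [Hrho Htube]].
  set (eta := Rmin eta0 (L / 2)).
  assert (Heta : 0 < eta) by (apply Rmin_pos; lra).
  assert (Heta1 : eta <= eta0) by apply Rmin_l. assert (Heta2 : eta <= L / 2) by apply Rmin_r.
  destruct (chord_bound_exists eta Heta) as [m [Hm Hchord]].
  set (d0 := Rmin (eta / 2) (Rmin (m / 6) (rho / 3))).
  exists eta, d0. split; [repeat apply Rmin_pos; lra |]. intros d Hd.
  assert (Hd1 : d <= eta / 2) by (apply Rle_trans with d0; [lra | apply Rmin_l]).
  assert (Hd' : d <= Rmin (m / 6) (rho / 3)) by (apply Rle_trans with d0; [lra | apply Rmin_r]).
  assert (Hd2 := Rle_trans _ _ _ Hd' (Rmin_l _ _)).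
  assert (Hd3 := Rle_trans _ _ _ Hd' (Rmin_r _ _)).
  split; try lra.
  - intros s s' Hs. apply Htan. lra.
  - intros s h Hh. apply Rle_trans with (2 := Hchord s h Hh). nra.
  - intros r s Hr. apply Htube. lra.
Qed.

Lemma fine_close_tangent (eta d s s' : R) : fine_scale eta d ->
  dist2 (trace s') (trace s) < (6 * d) ^ 2 -> 1 / 2 <= tangent_dot s s'.
Proof.
  intros F Hclose.
  destruct (near_or_far eta (6 * d) (fine_chord _ _ F) s s') as [[k Hk] |]; [| lra].
  rewrite <- (tangent_dot_IZR k). now apply (fine_tangent _ _ F).
Qed.

(** * The mollified winding number *)

(* The winding number of the curve around [p], mollified by the bump [bump d x * bump d y], is the
   integral along the curve of the 1-form [- bump d x * step d y dx]. *)
Definition winding (d : R) (p : R * R) : R :=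
  RInt (fun s => bump d (a1 s - fst p) * step d (a2 s - snd p) * - b1 s) 0 L.

Definition C1_path (g1 g2 h1 h2 : R -> R) : Prop :=
  (forall u, is_derive g1 u (h1 u)) /\ (forall u, is_derive g2 u (h2 u)) /\
  continuity h1 /\ continuity h2.

Lemma is_RInt_bump_step_derive (d p1 p2 : R) :
  is_RInt (fun s => bump_deriv d (a1 s - p1) * b1 s * step d (a2 s - p2)
                    + bump d (a1 s - p1) * (bump d (a2 s - p2) * b2 s)) 0 L 0.
Proof.
  apply (is_RInt_periodic_derive L (fun s => bump d (a1 s - p1) * step d (a2 s - p2))).
  - intros s. auto_derive; [easy | unfold Rminus; ring].
  - assert (H := continuity_bump d). assert (H' := continuity_bump_deriv d).
    assert (H'' := continuity_step d). reg.
  - intros s. now rewrite (periodic_a1 C), (periodic_a2 C).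
Qed.

(* Differentiating under the integral, the term in [bump_deriv] is integrated by parts along the
   curve. *)
Lemma is_derive_winding (d : R) (g1 g2 h1 h2 : R -> R) (x : R) : C1_path g1 g2 h1 h2 ->
  is_derive (fun u => winding d (g1 u, g2 u)) x
    (RInt (fun s => bump d (a1 s - g1 x) * bump d (a2 s - g2 x)
                    * (h2 x * b1 s - h1 x * b2 s)) 0 L).
Proof.
  intros (Hg1 & Hg2 & Ch1 & Ch2).
  pose (diff_g1 := {| UnaryDiff_H := Hg1 |} : UnaryDiff g1).
  pose (diff_g2 := {| UnaryDiff_H := Hg2 |} : UnaryDiff g2).
  assert (Cg1 := is_derive_continuity g1 h1 Hg1). assert (Cg2 := is_derive_continuity g2 h2 Hg2).
  assert (Cbump := continuity_bump d). assert (Cderiv := continuity_bump_deriv d).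
  assert (Cstep := continuity_step d).
  set (f := fun u s => bump d (a1 s - g1 u) * step d (a2 s - g2 u) * - b1 s).
  set (df := fun u s => (bump_deriv d (a1 s - g1 u) * h1 u * step d (a2 s - g2 u)
                         + bump d (a1 s - g1 u) * (bump d (a2 s - g2 u) * h2 u)) * b1 s).
  evar_last.
  - apply (is_derive_RInt_param_C1 f df).
    + intros u s. unfold f, df. auto_derive; [easy | unfold Rminus; simpl; ring].
    + intros u s. unfold df. continuity_2d.
    + intros u. unfold f. reg.
  - symmetry. apply is_RInt_unique.
    replace (RInt (df x) 0 L) with (RInt (df x) 0 L + - h1 x * 0) by ring.
    apply (is_RInt_plus_scal (df x) _ _ 0 L _ 0 (- h1 x)
             ltac:(apply is_RInt_continuity; unfold df; reg)
             (is_RInt_bump_step_derive d (g1 x) (g2 x))).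
    intros s. unfold df. ring.
Qed.

Lemma winding_mean_value (d : R) (g1 g2 h1 h2 : R -> R) (x y : R) : C1_path g1 g2 h1 h2 ->
  exists z, Rmin x y <= z <= Rmax x y /\
    winding d (g1 y, g2 y) - winding d (g1 x, g2 x) =
    RInt (fun s => bump d (a1 s - g1 z) * bump d (a2 s - g2 z)
                   * (h2 z * b1 s - h1 z * b2 s)) 0 L * (y - x).
Proof.
  intros G. assert (D := fun u => is_derive_winding d g1 g2 h1 h2 u G).
  apply (MVT_gen (fun u => winding d (g1 u, g2 u))).
  - intros u _. apply D.
  - intros u _. exact (is_derive_continuity _ _ D u).
Qed.

Lemma winding_nondecreasing (d : R) (g1 g2 h1 h2 : R -> R) (x y : R) :
  0 < d -> C1_path g1 g2 h1 h2 -> x <= y ->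
  (forall u s, x <= u <= y -> Rabs (a1 s - g1 u) < d -> Rabs (a2 s - g2 u) < d ->
     0 <= h2 u * b1 s - h1 u * b2 s) ->
  winding d (g1 x, g2 x) <= winding d (g1 y, g2 y).
Proof.
  intros Hd G Hxy Hcross. destruct (winding_mean_value d g1 g2 h1 h2 x y G) as [z [Hz E]].
  rewrite Rmin_left, Rmax_right in Hz by exact Hxy.
  set (f := fun s => _) in E.
  assert (Hf : 0 <= RInt f 0 L).
  { apply RInt_ge_0.
    - apply Rlt_le, (period_pos C).
    - exists (RInt f 0 L). apply is_RInt_continuity.
      assert (Cbump := continuity_bump d). unfold f. reg.
    - intros s _. unfold f.
      destruct (Rlt_le_dec (Rabs (a1 s - g1 z)) d) as [Hin1 | Hout1];
        [| rewrite bump_outside by assumption; lra].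
      destruct (Rlt_le_dec (Rabs (a2 s - g2 z)) d) as [Hin2 | Hout2];
        [| rewrite (bump_outside d Hd (a2 s - g2 z)) by assumption; lra].
      apply Rmult_le_pos; [apply Rmult_le_pos; now apply bump_ge0 | now apply Hcross]. }
  nra.
Qed.

Lemma far_weaken (r r' : R) (p : R * R) : Rabs r <= Rabs r' -> far r' p -> far r p.
Proof.
  intros Hr Hfar s. apply Rle_trans with (2 := Hfar s).
  rewrite <- (pow2_abs r), <- (pow2_abs r'). apply pow_incr.
  split; [apply Rabs_pos | exact Hr].
Qed.

Lemma far_bump_vanishes (d r p1 p2 s : R) :
  0 < d -> 2 * d <= Rabs r -> far r (p1, p2) -> bump d (a1 s - p1) * bump d (a2 s - p2) = 0.
Proof.
  intros Hd Hr Hfar. specialize (Hfar s).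
  unfold dist2, trace in Hfar. cbn [fst snd] in Hfar.
  destruct (Rle_lt_dec d (Rabs (a1 s - p1))) as [h1 | h1];
    [rewrite bump_outside by assumption; ring |].
  destruct (Rle_lt_dec d (Rabs (a2 s - p2))) as [h2 | h2];
    [rewrite (bump_outside d Hd (a2 s - p2)) by assumption; ring | exfalso].
  rewrite <- (pow2_abs r), <- (pow2_abs (a1 s - p1)), <- (pow2_abs (a2 s - p2)) in Hfar.
  assert (Hpos1 := Rabs_pos (a1 s - p1)). assert (Hpos2 := Rabs_pos (a2 s - p2)). nra.
Qed.

Definition joined (r : R) (p q : R * R) : Prop :=
  exists g1 g2 h1 h2, C1_path g1 g2 h1 h2 /\ (g1 0, g2 0) = p /\ (g1 1, g2 1) = q /\
    forall u, 0 <= u <= 1 -> far r (g1 u, g2 u).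

Lemma winding_joined (d r : R) (p q : R * R) :
  0 < d -> 2 * d <= Rabs r -> joined r p q -> winding d p = winding d q.
Proof.
  intros Hd Hr (g1 & g2 & h1 & h2 & G & <- & <- & Hfar).
  destruct (winding_mean_value d g1 g2 h1 h2 0 1 G) as [z [Hz E]].
  rewrite Rmin_left, Rmax_right in Hz by lra.
  rewrite (is_RInt_unique _ 0 L 0) in E; [lra |].
  apply is_RInt_vanishing. intros s _.
  rewrite (far_bump_vanishes d r) by auto. apply Rmult_0_l.
Qed.

Lemma C1_path_affine (p1 p2 v1 v2 : R) :
  C1_path (fun u => p1 + u * v1) (fun u => p2 + u * v2) (fun _ => v1) (fun _ => v2).
Proof.
  split; [| split; [| split]].
  - intros u. auto_derive; [exact I | ring].
  - intros u. auto_derive; [exact I | ring].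
  - now apply continuity_const.
  - now apply continuity_const.
Qed.

Lemma joined_segment (r p1 p2 q1 q2 : R) :
  (forall u, 0 <= u <= 1 -> far r (p1 + u * (q1 - p1), p2 + u * (q2 - p2))) ->
  joined r (p1, p2) (q1, q2).
Proof.
  intros Hfar.
  exists (fun u => p1 + u * (q1 - p1)), (fun u => p2 + u * (q2 - p2)).
  exists (fun _ => q1 - p1), (fun _ => q2 - p2).
  split; [apply C1_path_affine | split; [| split; [| exact Hfar]]].
  - f_equal; ring.
  - f_equal; ring.
Qed.

Lemma joined_offset_normal (D r s : R) :
  far D (offset D s) -> 0 <= r <= D \/ D <= r <= 0 -> joined r (offset D s) (offset r s).
Proof.
  intros HD Hr. apply joined_segment. intros u Hu. set (v := D + u * (r - D)).
  assert (Hv : 0 <= r <= v /\ v <= D \/ D <= v /\ v <= r <= 0) by (unfold v; destruct Hr; nra).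
  replace (_, _) with (offset v s) by (unfold v, offset; f_equal; ring).
  apply (far_weaken r v).
  - destruct Hv; [rewrite !Rabs_pos_eq | rewrite !Rabs_left1]; lra.
  - apply (far_offset_between D); [exact HD | destruct Hv; lra].
Qed.

Lemma joined_offset_parallel (r s s' : R) :
  (forall s, far r (offset r s)) -> joined r (offset r s) (offset r s').
Proof.
  intros Hfar. set (q := fun u => s + u * (s' - s)).
  exists (fun u => a1 (q u) - r * b2 (q u)), (fun u => a2 (q u) + r * b1 (q u)).
  exists (fun u => (b1 (q u) - r * c2 (q u)) * (s' - s)).
  exists (fun u => (b2 (q u) + r * c1 (q u)) * (s' - s)).
  split; [split; [| split; [| split]] | split; [| split]].
  - intros u. unfold q. auto_derive; [easy | ring].
  - intros u. unfold q. auto_derive; [easy | ring].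
  - unfold q. reg.
  - unfold q. reg.
  - unfold q. now rewrite Rmult_0_l, Rplus_0_r.
  - unfold q. now replace (s + 1 * (s' - s)) with s' by ring.
  - intros u _. exact (Hfar (q u)).
Qed.

Lemma winding_from_below (d : R) (p : R * R) :
  winding d p =
  RInt (fun s => bump d (a1 s - fst p) * (1 - step d (a2 s - snd p)) * b1 s) 0 L.
Proof.
  destruct p as [p1 p2]. unfold winding. cbn [fst snd].
  assert (Cbump := continuity_bump d). assert (Cstep := continuity_step d).
  assert (I0 : is_RInt (fun s => b1 s * bump d (a1 s - p1)) 0 L 0).
  { apply (is_RInt_periodic_derive L (fun s => step d (a1 s - p1))).
    - intros s. auto_derive; [easy | unfold Rminus; ring].
    - reg.
    - intros s. now rewrite (periodic_a1 C). }
  set (f := fun s => bump d (a1 s - p1) * step d (a2 s - p2) * - b1 s).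
  assert (If : is_RInt f 0 L (RInt f 0 L)) by (apply is_RInt_continuity; unfold f; reg).
  replace (RInt f 0 L) with (0 + 1 * RInt f 0 L) by ring.
  symmetry. apply is_RInt_unique, (is_RInt_plus_scal _ f _ 0 L 0 _ 1 I0 If).
  intros s. unfold f. ring.
Qed.

Lemma winding_below (d : R) (p : R * R) :
  0 < d -> (forall s, d <= a2 s - snd p) -> winding d p = 0.
Proof.
  intros Hd Hp. rewrite winding_from_below.
  apply is_RInt_unique, is_RInt_vanishing. intros s _.
  rewrite step_right by auto. ring.
Qed.

Definition bottom (s0 : R) : Prop := (forall s, a2 s0 <= a2 s) /\ b1 s0 = 1.

Lemma bottom_b2 (s0 : R) : bottom s0 -> b2 s0 = 0.
Proof.
  intros [_ Hb1]. assert (U := unit_speed C s0). rewrite Hb1 in U. nra.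
Qed.

Lemma bottom_offset (r s0 : R) : bottom s0 -> offset r s0 = (a1 s0, a2 s0 + r).
Proof.
  intros H. unfold offset. rewrite (bottom_b2 s0 H), (proj2 H). f_equal; ring.
Qed.

Lemma bottom_arc (eta d s0 s : R) : fine_scale eta d -> bottom s0 -> Rabs (s - s0) <= eta ->
  exists z, 1 / 2 <= z /\ a1 s - a1 s0 = z * (s - s0).
Proof.
  intros F B Hs. destruct (chord_tangential_mean_value s0 s) as [z [Hz E]].
  exists (tangent_dot s0 z). split; [apply (fine_tangent _ _ F); lra |].
  rewrite <- E. unfold chord_tangential. rewrite (bottom_b2 s0 B), (proj2 B). ring.
Qed.

Lemma a2_lipschitz (s s' : R) : Rabs (a2 s' - a2 s) <= Rabs (s' - s).
Proof.
  rewrite <- (Rmult_1_l (Rabs (s' - s))).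
  apply (lipschitz_of_derive_bound a2 b2); [exact (is_derive_a2 C) |].
  intros z. exact (proj2 (unit_vector_bound _ _ (unit_speed C z))).
Qed.

Section WindingValues.

Variables (eta d s0 : R).
Hypotheses (F : fine_scale eta d) (B : bottom s0).

Let integrand (s : R) : R :=
  bump d (a1 s - a1 s0) * (1 - step d (a2 s - (a2 s0 + 3 * d))) * b1 s.

Lemma above_bottom_near_arc (s : R) : Rabs (s - s0) <= eta ->
  integrand s = b1 s * bump d (a1 s - a1 s0).
Proof.
  intros Hs. assert (Hd := fine_pos _ _ F). unfold integrand.
  destruct (Rle_lt_dec d (Rabs (a1 s - a1 s0))) as [h | h];
    [rewrite bump_outside by assumption; ring |].
  rewrite step_left; [ring | exact Hd |].
  destruct (bottom_arc eta d s0 s F B Hs) as [z [Hz Ez]].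
  rewrite Ez, Rabs_mult, (Rabs_pos_eq z) in h by lra.
  assert (Hs' : Rabs (s - s0) < 2 * d) by (assert (Z := Rabs_pos (s - s0)); nra).
  assert (Hlip := a2_lipschitz s0 s). assert (Z := Rle_abs (a2 s - a2 s0)). lra.
Qed.

Lemma above_bottom_far_arc (s : R) : eta <= s - s0 <= L - eta -> integrand s = 0.
Proof.
  intros Hs. assert (Hd := fine_pos _ _ F). unfold integrand.
  destruct (Rle_lt_dec d (Rabs (a1 s - a1 s0))) as [h | h];
    [rewrite bump_outside by assumption; ring |].
  rewrite step_right; [ring | exact Hd |].
  assert (Hchord := fine_chord _ _ F s0 (s - s0) Hs).
  replace (s0 + (s - s0)) with s in Hchord by ring.
  unfold dist2, trace in Hchord. cbn [fst snd] in Hchord.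
  apply Rabs_def2 in h. assert (Hmin := proj1 B s).
  destruct (Rle_lt_dec d (a2 s - (a2 s0 + 3 * d))); [assumption | nra].
Qed.

(* Just above the bottom only the arc through it is seen from below, and it passes from left to
   right. *)
Lemma winding_above_bottom : winding d (offset (3 * d) s0) = 1.
Proof.
  assert (Hd := fine_pos _ _ F). assert (Heta := fine_arc _ _ F).
  assert (Cbump := continuity_bump d). assert (Cstep := continuity_step d).
  rewrite bottom_offset, winding_from_below by exact B. cbn [fst snd]. fold integrand.
  rewrite <- (RInt_periodic L (s0 - eta) integrand).
  - apply is_RInt_unique. replace 1 with (1 + 0) by ring.
    apply (is_RInt_Chasles integrand (s0 - eta) (s0 + eta) (s0 - eta + L)).
    + apply (is_RInt_ext (fun s => b1 s * bump d (a1 s - a1 s0))).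
      * intros s. rewrite Rmin_left, Rmax_right by lra. intros Hs.
        symmetry. apply above_bottom_near_arc, Rabs_le. lra.
      * destruct (bottom_arc eta d s0 (s0 + eta) F B) as [z [Hz Ez]]; [rewrite Rabs_pos_eq; lra |].
        destruct (bottom_arc eta d s0 (s0 - eta) F B) as [y [Hy Ey]]; [rewrite Rabs_left; lra |].
        replace 1 with (step d (a1 (s0 + eta) - a1 s0) - step d (a1 (s0 - eta) - a1 s0))
          by (rewrite Ez, Ey, step_right, step_left by nra; ring).
        apply (is_RInt_derive_continuity (fun s => step d (a1 s - a1 s0))); [| reg].
        intros s. auto_derive; [easy | unfold Rminus; ring].
    + apply is_RInt_vanishing. intros s. rewrite Rmin_left, Rmax_right by lra. intros Hs.
      apply above_bottom_far_arc. lra.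
  - unfold integrand. reg.
  - intros s. unfold integrand. now rewrite (periodic_a1 C), (periodic_a2 C), periodic_b1.
Qed.

Lemma winding_left_side (D s : R) : 3 * d <= D -> far D (offset D s) -> winding d (offset D s) = 1.
Proof.
  intros HD Hfar. assert (Hd := fine_pos _ _ F).
  assert (Hwidth : 2 * d <= Rabs (3 * d) <= 3 * d) by (rewrite Rabs_pos_eq; lra).
  rewrite (winding_joined d (3 * d) _ (offset (3 * d) s)); [| exact Hd | lra |].
  - rewrite (winding_joined d (3 * d) _ (offset (3 * d) s0)); [| exact Hd | lra |].
    + exact winding_above_bottom.
    + apply joined_offset_parallel. intros s'. apply (fine_tube _ _ F). lra.
  - apply joined_offset_normal; [exact Hfar | lra].
Qed.

Lemma winding_right_side (D s : R) : D <= - (3 * d) -> far D (offset D s) ->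
  winding d (offset D s) = 0.
Proof.
  intros HD Hfar. assert (Hd := fine_pos _ _ F).
  assert (Hwidth : 2 * d <= Rabs (- (3 * d)) <= 3 * d) by (rewrite Rabs_left; lra).
  rewrite (winding_joined d (- (3 * d)) _ (offset (- (3 * d)) s)); [| exact Hd | lra |].
  - rewrite (winding_joined d (- (3 * d)) _ (offset (- (3 * d)) s0)); [| exact Hd | lra |].
    + apply winding_below; [exact Hd |]. intros s'. rewrite bottom_offset by exact B. simpl.
      assert (Hmin := proj1 B s'). lra.
    + apply joined_offset_parallel. intros s'. apply (fine_tube _ _ F). lra.
  - apply joined_offset_normal; [exact Hfar | lra].
Qed.

Lemma winding_crossing (x y s : R) : - (3 * d) <= x -> x <= y -> y <= 3 * d ->
  winding d (offset x s) <= winding d (offset y s).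
Proof.
  intros Hx Hxy Hy. assert (Hd := fine_pos _ _ F).
  replace (offset x s) with (a1 s + x * - b2 s, a2 s + x * b1 s) by (unfold offset; f_equal; ring).
  replace (offset y s) with (a1 s + y * - b2 s, a2 s + y * b1 s) by (unfold offset; f_equal; ring).
  apply (winding_nondecreasing d _ _ _ _ x y Hd (C1_path_affine (a1 s) (a2 s) (- b2 s) (b1 s)) Hxy).
  intros u s' Hu Hnear1%Rabs_def2 Hnear2%Rabs_def2.
  destruct (unit_vector_bound _ _ (unit_speed C s)) as [U1%Rabs_le_between U2%Rabs_le_between].
  assert (Hclose : dist2 (trace s') (trace s) < (6 * d) ^ 2).
  { unfold dist2, trace. cbn [fst snd].
    assert (Hclose1 : - (4 * d) < a1 s' - a1 s < 4 * d) by nra.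
    assert (Hclose2 : - (4 * d) < a2 s' - a2 s < 4 * d) by nra. nra. }
  assert (Htan := fine_close_tangent eta d s s' F Hclose). unfold tangent_dot in Htan. lra.
Qed.

Lemma winding_ge0 (p : R * R) : 0 <= winding d p.
Proof.
  destruct (nearest_offset p) as (s & D & -> & Hfar).
  destruct (Rle_lt_dec (3 * d) D) as [HD | HD]; [rewrite winding_left_side by assumption; lra |].
  destruct (Rle_lt_dec D (- (3 * d))) as [HD' | HD'];
    [rewrite winding_right_side by assumption; lra |].
  assert (Hd := fine_pos _ _ F).
  rewrite <- (winding_right_side (- (3 * d)) s).
  - apply winding_crossing; lra.
  - lra.
  - apply (fine_tube _ _ F). rewrite Rabs_left; lra.
Qed.

End WindingValues.

Definition signed_area : R := / 2 * RInt (fun s => a1 s * b2 s - a2 s * b1 s) 0 L.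

Lemma signed_area_eq : signed_area = RInt (fun s => a2 s * - b1 s) 0 L.
Proof.
  assert (I0 : is_RInt (fun s => a1 s * b2 s + a2 s * b1 s) 0 L 0).
  { apply (is_RInt_periodic_derive L (fun s => a1 s * a2 s)).
    - intros s. auto_derive; [easy | ring].
    - reg.
    - intros s. now rewrite (periodic_a1 C), (periodic_a2 C). }
  set (f := fun s => a2 s * - b1 s).
  assert (If : is_RInt f 0 L (RInt f 0 L)) by (apply is_RInt_continuity; unfold f; reg).
  unfold signed_area. rewrite (is_RInt_unique _ 0 L (0 + 2 * RInt f 0 L)); [field |].
  apply (is_RInt_plus_scal _ f _ 0 L 0 _ 2 I0 If). intros s. unfold f. ring.
Qed.

Lemma is_RInt2_winding (d M : R) : 0 < d ->
  (forall s, Rabs (a1 s) + d <= M) -> (forall s, Rabs (a2 s) + d <= M) ->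
  is_RInt2 (fun x y => winding d (x, y)) (- M) M (- M) M signed_area.
Proof.
  intros Hd HM1 HM2. rewrite signed_area_eq.
  assert (Cbump := continuity_bump d). assert (Cstep := continuity_step d).
  assert (Hshift : forall t, Rabs t + d <= M -> d <= t + M /\ t - M <= - d).
  { intros t Ht. assert (Ht' := proj1 (Rabs_le_between t (Rabs t)) (Rle_refl _)). lra. }
  destruct (is_RInt_step_reflected d Hd M) as [c Hc].
  set (w := fun s => (a2 s + c) * - b1 s).
  exists (fun x => RInt (fun s => bump d (a1 s - x) * w s) 0 L). split.
  - intros x.
    apply (is_RInt_swap_order (fun y s => bump d (a1 s - x) * step d (a2 s - y) * - b1 s)).
    + intros y s. continuity_2d.
    + intros s. destruct (Hshift (a2 s) (HM2 s)) as [Hright Hleft].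
      replace (bump d (a1 s - x) * w s) with (bump d (a1 s - x) * - b1 s * (a2 s + c))
        by (unfold w; ring).
      apply (is_RInt_ext (fun y => bump d (a1 s - x) * - b1 s * step d (a2 s - y)));
        [intros y _; simpl; ring |].
      exact (is_RInt_scal _ _ _ (bump d (a1 s - x) * - b1 s) _ (Hc (a2 s) Hright Hleft)).
  - replace (RInt (fun s => a2 s * - b1 s) 0 L) with (RInt w 0 L).
    + apply (is_RInt_swap_order (fun x s => bump d (a1 s - x) * w s)).
      * intros x s. unfold w. continuity_2d.
      * intros s. destruct (Hshift (a1 s) (HM1 s)) as [Hright Hleft].
        rewrite <- (Rmult_1_r (w s)).
        apply (is_RInt_ext (fun x => w s * bump d (a1 s - x))); [intros x _; simpl; ring |].
        exact (is_RInt_scal _ _ _ (w s) _ (is_RInt_bump_reflected d Hd M (a1 s) Hright Hleft)).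
    + set (f := fun s => a2 s * - b1 s).
      assert (If : is_RInt f 0 L (RInt f 0 L)) by (apply is_RInt_continuity; unfold f; reg).
      assert (Ib := is_RInt_periodic_derive L a1 b1 (is_derive_a1 C) Cb1 (periodic_a1 C)).
      replace (RInt f 0 L) with (RInt f 0 L + - c * 0) by ring.
      apply is_RInt_unique, (is_RInt_plus_scal f b1 w 0 L _ 0 (- c) If Ib).
      intros s. unfold f, w. ring.
Qed.

(** * The enclosed domain *)

Lemma far_not_onC (r : R) (p : R * R) : r <> 0 -> far r p -> ~ onC a1 a2 p.
Proof.
  intros Hr Hfar [s ->]. specialize (Hfar s).
  unfold dist2, trace in Hfar. rewrite !Rminus_diag in Hfar. apply pow2_gt_0 in Hr. lra.
Qed.

Lemma inside_path (g1 g2 : R -> R) : continuity g1 -> continuity g2 ->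
  inside a1 a2 (g1 0, g2 0) ->
  (forall u, 0 <= u <= 1 -> ~ onC a1 a2 (g1 u, g2 u)) ->
  inside a1 a2 (g1 1, g2 1).
Proof.
  intros Cg1 Cg2 [_ [Rb Hbound]] Hg. split; [apply Hg; lra |].
  exists Rb. intros k1 k2 Ck1 Ck2 E Hk u Hu. injection E as E1 E2.
  change (continuity k1) in Ck1. change (continuity k2) in Ck2.
  assert (Cc := continuity_clamp 0 1).
  set (first := fun v => clamp 0 1 (2 * v)). set (second := fun v => clamp 0 1 (2 * v - 1)).
  set (f1 := fun v => g1 (first v) + k1 (second v) - g1 1).
  set (f2 := fun v => g2 (first v) + k2 (second v) - g2 1).
  assert (Hfirst : forall v, 0 <= v <= 1 / 2 -> f1 v = g1 (2 * v) /\ f2 v = g2 (2 * v)).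
  { intros v Hv. unfold f1, f2, first, second.
    rewrite (clamp_id 0 1 (2 * v)), (clamp_left 0 1 (2 * v - 1)), E1, E2 by lra. lra. }
  assert (Hsecond : forall v, 1 / 2 <= v <= 1 -> f1 v = k1 (2 * v - 1) /\ f2 v = k2 (2 * v - 1)).
  { intros v Hv. unfold f1, f2, first, second.
    rewrite (clamp_right 0 1 (2 * v)), (clamp_id 0 1 (2 * v - 1)) by lra. lra. }
  destruct (Hsecond ((u + 1) / 2)) as [Ef1 Ef2]; [lra |].
  replace (2 * ((u + 1) / 2) - 1) with u in Ef1, Ef2 by field.
  rewrite <- Ef1, <- Ef2. apply Hbound; [| | | | lra].
  - intros v. unfold f1, first, second. reg.
  - intros v. unfold f2, first, second. reg.
  - destruct (Hfirst 0) as [-> ->]; [lra |]. now rewrite Rmult_0_r.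
  - intros v Hv. destruct (Rle_lt_dec v (1 / 2)) as [h | h].
    + destruct (Hfirst v) as [-> ->]; [lra |]. apply Hg. lra.
    + destruct (Hsecond v) as [-> ->]; [lra |]. apply Hk. lra.
Qed.

Lemma inside_joined (r : R) (p q : R * R) :
  r <> 0 -> joined r p q -> inside a1 a2 p -> inside a1 a2 q.
Proof.
  intros Hr (g1 & g2 & h1 & h2 & (Hg1 & Hg2 & _) & <- & <- & Hfar) Hin.
  apply inside_path; [| | exact Hin |].
  - exact (is_derive_continuity g1 h1 Hg1).
  - exact (is_derive_continuity g2 h2 Hg2).
  - intros u Hu. exact (far_not_onC r _ Hr (Hfar u Hu)).
Qed.

Lemma below_not_inside (p : R * R) : (forall s, snd p < a2 s) -> ~ inside a1 a2 p.
Proof.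
  destruct p as [p1 p2]. simpl. intros Hp [_ [Rb Hbound]].
  set (T := Rabs p2 + Rabs Rb + 1).
  assert (Hp2 := Rabs_pos p2). assert (HRb := Rabs_pos Rb). assert (Hp2' := Rle_abs p2).
  assert (H : p1 ^ 2 + (p2 - 1 * T) ^ 2 <= Rb ^ 2).
  { apply (Hbound (fun _ => p1) (fun u => p2 - u * T)).
    - intros u. now apply continuity_pt_const.
    - intros u. reg.
    - now rewrite Rmult_0_l, Rminus_0_r.
    - intros u Hu [s E]. injection E as _ E. specialize (Hp s). unfold T in E. nra.
    - lra. }
  rewrite <- (pow2_abs Rb) in H. assert (Hp1 := pow2_ge_0 p1). unfold T in H. nra.
Qed.

Lemma right_side_not_inside (s0 D s : R) : bottom s0 -> D < 0 ->
  far D (offset D s) -> ~ inside a1 a2 (offset D s).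
Proof.
  intros B HD Hfar Hin. destruct far_offset_small as [rho [Hrho Htube]].
  assert (Hmin : 0 < Rmin rho (- D)) by (apply Rmin_pos; lra).
  assert (Hl := Rmin_l rho (- D)). assert (Hr := Rmin_r rho (- D)).
  set (r := - Rmin rho (- D)). assert (Hr0 : r < 0) by (unfold r; lra).
  apply (below_not_inside (offset r s0)).
  { intros s'. rewrite bottom_offset by exact B. simpl. assert (H := proj1 B s'). lra. }
  apply (inside_joined r (offset r s)); [lra | |].
  - apply joined_offset_parallel. intros s'. apply Htube.
    rewrite Rabs_left by lra. unfold r. lra.
  - apply (inside_joined r (offset D s)); [lra | | exact Hin].
    apply joined_offset_normal; [exact Hfar | unfold r; lra].
Qed.

Lemma inside_nearest_offset (s0 : R) (p : R * R) : bottom s0 -> inside a1 a2 p ->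
  exists s D, 0 < D /\ p = offset D s /\ far D p.
Proof.
  intros B Hin. destruct (nearest_offset p) as (s & D & E & Hfar).
  exists s, D. split; [| now split].
  destruct (Rtotal_order D 0) as [h | [h | h]]; [exfalso | exfalso | exact h]; subst p.
  - exact (right_side_not_inside s0 D s B h Hfar Hin).
  - apply (proj1 Hin). exists s. unfold offset. rewrite h. f_equal; ring.
Qed.

Lemma winding_inside (eta d s0 : R) (p : R * R) : fine_scale eta d -> bottom s0 ->
  inside a1 a2 p -> far (3 * d) p -> winding d p = 1.
Proof.
  intros F B Hin Hfar. assert (Hd := fine_pos _ _ F).
  destruct (inside_nearest_offset s0 p B Hin) as (s & D & HD & -> & HfarD).
  apply (winding_left_side eta d s0 F B); [| exact HfarD].
  specialize (Hfar s). rewrite dist2_offset in Hfar.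
  unfold dist2, chord_normal in Hfar. rewrite !Rminus_diag in Hfar. nra.
Qed.

Lemma counterclockwise_bottom :
  (forall s, exists del, 0 < del /\ forall e, 0 < e < del -> inside a1 a2 (offset e s)) ->
  exists s0, bottom s0.
Proof.
  intros Hleft. destruct (periodic_min L a2 (period_pos C) (periodic_a2 C) Ca2) as [s0 Hs0].
  exists s0. split; [exact Hs0 |].
  assert (E := is_derive_minimum a2 s0 _ (is_derive_a2 C s0) Hs0).
  assert (U := unit_speed C s0). rewrite E in U.
  assert (H : (b1 s0 - 1) * (b1 s0 + 1) = 0) by lra.
  destruct (Rmult_integral _ _ H) as [h | h]; [lra | exfalso].
  destruct (Hleft s0) as [del [Hdel Hin]]. specialize (Hin (del / 2) ltac:(lra)).
  revert Hin. apply below_not_inside. intros s. simpl.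
  specialize (Hs0 s). replace (b1 s0) with (-1) by lra. lra.
Qed.

Lemma far_perturb (r p1 p2 q1 q2 : R) : far r (p1, p2) ->
  4 * Rabs (q1 - p1) <= Rabs r -> 4 * Rabs (q2 - p2) <= Rabs r -> far (r / 2) (q1, q2).
Proof.
  intros Hfar Hq1 Hq2 s. specialize (Hfar s). revert Hfar. unfold dist2, trace. cbn [fst snd].
  assert (Hsqr : forall x, 4 * Rabs x <= Rabs r -> 16 * x ^ 2 <= r ^ 2).
  { intros x Hx. rewrite <- (pow2_abs x), <- (pow2_abs r). assert (Z := Rabs_pos x). nra. }
  assert (Hsqr1 := Hsqr _ Hq1). assert (Hsqr2 := Hsqr _ Hq2).
  assert (Hpos1 := pow2_ge_0 (a1 s - q1 - (q1 - p1))).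
  assert (Hpos2 := pow2_ge_0 (a2 s - q2 - (q2 - p2))).
  nra.
Qed.

Lemma inside_contains_rect (p : R * R) : inside a1 a2 p ->
  exists r, rect_ok (inside a1 a2) r /\ 0 < rect_area r.
Proof.
  intros Hin. destruct (nearest_offset p) as (s & D & E & Hfar).
  assert (HD : D <> 0).
  { intros HD. apply (proj1 Hin). exists s. rewrite E, HD. unfold offset. f_equal; ring. }
  clear s E. destruct p as [p1 p2].
  assert (Hh := Rabs_pos_lt D HD). set (h := Rabs D / 4).
  exists (p1 - h, p1 + h, p2 - h, p2 + h). simpl.
  split; [split; [unfold h; lra | split; [unfold h; lra |]] | unfold h; nra].
  intros x y Hx Hy. apply (inside_joined (D / 2) (p1, p2)); [lra | | exact Hin].
  apply joined_segment. intros u Hu. apply (far_perturb D p1 p2); [exact Hfar | |].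
  - replace (p1 + u * (x - p1) - p1) with (u * (x - p1)) by ring.
    assert (Rabs (u * (x - p1)) <= h) by (apply Rabs_le; nra). unfold h in *. lra.
  - replace (p2 + u * (y - p2) - p2) with (u * (y - p2)) by ring.
    assert (Rabs (u * (y - p2)) <= h) by (apply Rabs_le; nra). unfold h in *. lra.
Qed.

Lemma rect_far (r : rect) : rect_ok (inside a1 a2) r ->
  exists eta, 0 < eta /\ forall x y, in_rect r x y -> far eta (x, y).
Proof.
  destruct r as [[[x0 x1] y0] y1]. simpl. intros (Hx & Hy & Hin).
  assert (Cx := continuity_clamp x0 x1). assert (Cy := continuity_clamp y0 y1).
  set (f := fun s => (a1 s - clamp x0 x1 (a1 s)) ^ 2 + (a2 s - clamp y0 y1 (a2 s)) ^ 2).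
  destruct (periodic_min L f (period_pos C)) as [s0 Hs0].
  - intros s. unfold f. now rewrite (periodic_a1 C), (periodic_a2 C).
  - unfold f. reg.
  - assert (Hf : 0 < f s0).
    { destruct (Rle_lt_dec (f s0) 0) as [Hle0 |]; [exfalso | assumption].
      destruct (sum_sqr_le0 _ _ Hle0) as [E1%Rminus_diag_uniq E2%Rminus_diag_uniq].
      assert (Hin0 := Hin _ _ (clamp_between x0 x1 (a1 s0) ltac:(lra))
                              (clamp_between y0 y1 (a2 s0) ltac:(lra))).
      apply (proj1 Hin0). exists s0. now rewrite <- E1, <- E2. }
    exists (sqrt (f s0)). split; [now apply sqrt_lt_R0 |]. intros x y [Hx' Hy'] s.
    rewrite pow2_sqrt by lra. apply Rle_trans with (1 := Hs0 s).
    apply Rplus_le_compat; now apply clamp_nearest.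
Qed.

Lemma rects_far (rs : list rect) : List.Forall (rect_ok (inside a1 a2)) rs ->
  exists eta, 0 < eta /\ forall r x y, In r rs -> in_rect r x y -> far eta (x, y).
Proof.
  induction 1 as [| r rs Hr _ [eta [Heta IH]]].
  - exists 1. split; [lra |]. intros r x y [].
  - destruct (rect_far r Hr) as [eta' [Heta' Hfar]].
    assert (Hmin : 0 < Rmin eta eta') by (apply Rmin_pos; lra).
    exists (Rmin eta eta'). split; [exact Hmin |].
    intros r' x y [<- | Hin] Hxy.
    + apply (far_weaken _ eta'); [rewrite !Rabs_pos_eq by lra; apply Rmin_r | auto].
    + apply (far_weaken _ eta); [rewrite !Rabs_pos_eq by lra; apply Rmin_l | eauto].
Qed.

Lemma rects_area_le (s0 : R) (rs : list rect) : bottom s0 ->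
  List.Forall (rect_ok (inside a1 a2)) rs -> rects_disj rs -> rects_area rs <= signed_area.
Proof.
  intros B Hok Hdisj.
  destruct fine_scale_exists as (eta & d0 & Hd0 & Hfine).
  destruct (rects_far rs Hok) as [dist [Hdist Hfar]].
  set (d := Rmin d0 (dist / 3)).
  assert (Hd : 0 < d) by (apply Rmin_pos; lra).
  assert (Hd1 : d <= d0) by apply Rmin_l. assert (Hd2 : d <= dist / 3) by apply Rmin_r.
  assert (F := Hfine d (conj Hd Hd1)).
  destruct (periodic_bounded L a1 (period_pos C) (periodic_a1 C) Ca1) as [K1 HK1].
  destruct (periodic_bounded L a2 (period_pos C) (periodic_a2 C) Ca2) as [K2 HK2].
  assert (HK1pos := Rle_trans _ _ _ (Rabs_pos _) (HK1 0)).
  assert (HK2pos := Rle_trans _ _ _ (Rabs_pos _) (HK2 0)).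
  destruct (rects_in_square _ rs (K1 + K2 + d) Hok) as [M [HM Hsq]].
  apply (is_RInt2_le (rects_indicator rs) (fun x y => winding d (x, y)) (- M) M (- M) M); try lra.
  - now apply is_RInt2_rects_indicator.
  - apply is_RInt2_winding; [exact Hd | |].
    + intros s. specialize (HK1 s). lra.
    + intros s. specialize (HK2 s). lra.
  - intros x y. destruct (rects_indicator_cases rs x y Hdisj) as [-> | [-> (r & Hr & Hin)]].
    + exact (winding_ge0 eta d s0 F B (x, y)).
    + rewrite (winding_inside eta d s0); [lra | exact F | exact B | |].
      * rewrite List.Forall_forall in Hok. specialize (Hok r Hr).
        destruct r as [[[x0 x1] y0] y1]. simpl in Hok, Hin. now apply Hok.
      * apply (far_weaken _ dist); [rewrite !Rabs_pos_eq; lra | exact (Hfar r x y Hr Hin)].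
Qed.

Lemma area_le_signed_area (s0 A : R) : bottom s0 -> is_area (inside a1 a2) A -> A <= signed_area.
Proof.
  intros B [_ Hlub]. apply Hlub. intros x (rs & Hok & Hdisj & ->).
  exact (rects_area_le s0 rs B Hok Hdisj).
Qed.

Lemma area_pos (p : R * R) (A : R) : inside a1 a2 p -> is_area (inside a1 a2) A -> 0 < A.
Proof.
  intros Hin [Hub _]. destruct (inside_contains_rect p Hin) as [r [Hr Hpos]].
  apply Rlt_le_trans with (1 := Hpos). apply Hub.
  exists (r :: nil). split; [auto | split; [now split |]]. simpl. ring.
Qed.

End ClosedCurve.

Lemma smooth_unit_speed_curve (L : R) (a1 a2 : R -> R) :
  0 < L -> smooth a1 -> smooth a2 -> periodic L a1 -> periodic L a2 ->
  (forall s, Der a1 s ^ 2 + Der a2 s ^ 2 = 1) ->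
  (forall s s', 0 <= s < L -> 0 <= s' < L -> a1 s = a1 s' -> a2 s = a2 s' -> s = s') ->
  unit_speed_curve L a1 a2 (Der a1) (Der a2) (nDer 2 a1) (nDer 2 a2).
Proof.
  intros HL Hs1 Hs2 Hp1 Hp2 Hunit Hinj. split; auto.
  - intros s. exact (smooth_is_derive a1 0 s Hs1).
  - intros s. exact (smooth_is_derive a2 0 s Hs2).
  - intros s. exact (smooth_is_derive a1 1 s Hs1).
  - intros s. exact (smooth_is_derive a2 1 s Hs2).
  - exact (smooth_continuity a1 2 Hs1).
  - exact (smooth_continuity a2 2 Hs2).
Qed.

Lemma height_le_of_area_bound (l L a A : R) : 0 < l -> 0 < a -> 0 < A ->
  4 * a * A <= (PI / l) ^ 2 * L -> l <= PI / 2 * sqrt (L / (a * A)).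
Proof.
  intros Hl Ha HA H. assert (HP := PI_RGT_0).
  assert (HaA : 0 < a * A) by now apply Rmult_lt_0_compat.
  assert (Hsq : (2 * l / PI) ^ 2 <= L / (a * A)).
  { apply (Rle_div_r _ L (a * A) HaA).
    apply Rle_trans with ((l / PI) ^ 2 * (4 * a * A)); [right; field; lra |].
    apply Rle_trans with ((l / PI) ^ 2 * ((PI / l) ^ 2 * L)).
    - apply Rmult_le_compat_l; [apply pow2_ge_0 | exact H].
    - right. field. lra. }
  apply sqrt_le_1_alt in Hsq. rewrite sqrt_pow2 in Hsq by (apply Rlt_le, Rdiv_lt_0_compat; lra).
  apply Rle_trans with (PI / 2 * (2 * l / PI)); [right; field; lra |].
  apply Rmult_le_compat_l; lra.
Qed.

Theorem theorem1 (a1 a2 : R -> R) (L l a b A : R) :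
  0 < L -> 0 < l ->
  smooth a1 -> smooth a2 ->
  (* L-periodic *)
  (forall s, a1 (s + L) = a1 s /\ a2 (s + L) = a2 s) ->
  (* arc-length parametrized *)
  (forall s, Der a1 s ^ 2 + Der a2 s ^ 2 = 1) ->
  (* the trace is a simple closed curve (of length L) *)
  (forall s s', 0 <= s < L -> 0 <= s' < L ->
     a1 s = a1 s' -> a2 s = a2 s' -> s = s') ->
  (* traversed counterclockwise: the enclosed domain lies to the left,
     i.e. on the side of n = J alpha' *)
  (forall s, exists del, 0 < del /\ forall e, 0 < e < del ->
     inside a1 a2 (a1 s - e * Der a2 s, a2 s + e * Der a1 s)) ->
  (* A = |Omega| *)
  is_area (inside a1 a2) A ->
  (* rotating stationary: 2H = a (x1^2 + x2^2) + b on M *)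
  (forall t s, 0 <= t <= l ->
     twoH a1 a2 t s = a * (vx (xM a1 a2 t s) ^ 2 + vy (xM a1 a2 t s) ^ 2) + b) ->
  0 < a ->
  stable a1 a2 L l a ->
  l <= PI / 2 * sqrt (L / (a * A)).
Proof.
  intros HL Hl H1 H2 Hper Hunit Hinj Hleft Harea _ Ha Hst.
  assert (Hp1 : periodic L a1) by (intros s; apply Hper).
  assert (Hp2 : periodic L a2) by (intros s; apply Hper).
  assert (C := smooth_unit_speed_curve L a1 a2 HL H1 H2 Hp1 Hp2 Hunit Hinj).
  destruct (counterclockwise_bottom _ _ _ _ _ _ _ C Hleft) as [s0 B].
  assert (HA : 0 < A).
  { destruct (Hleft 0) as [del [Hdel Hin]].
    exact (area_pos _ _ _ _ _ _ _ C _ A (Hin (del / 2) ltac:(lra)) Harea). }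
  assert (Hle := area_le_signed_area _ _ _ _ _ _ _ C s0 A B Harea).
  assert (Hbound := stable_column_bound a1 a2 L l a Hl H1 H2 Hunit Hp1 Hp2 Hst).
  apply height_le_of_area_bound; [exact Hl | exact Ha | exact HA |].
  unfold signed_area in Hle. nra.
Qed.
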